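(* Let $V$ be a $\mathbb{Z}$-graded real vector space, $I=[0,1]$, and let $\alpha$ be a total-degree-one solution of the Maurer-Cartan equation on $I$ with values in $\mathfrak g=\prod_{n\ge 0}\mathrm{Hom}(V^{\otimes n},V[1-n+\bullet])$, with components $\alpha^{0,n}=\mu^n_t$ and $\alpha^{1,n}=dt\otimes a^n_t$ ($t\in I$), such that $\alpha^{0,0}=\alpha^{1,0}=0$. For each $t\in I$ let $\mathcal A_t=(V,(\mu_t^n)_{n\ge1})$ be the corresponding $A_\infty$ algebra. Suppose that $\alpha^{1,1}=0$. For $p,q\in I$ define $$\mathscr F^1_{p\to q}=\mathrm{Id}_V,\qquad \mathscr F^n_{p\to q}=\sum_{i=1}^{n-1}(-1)^i\int_{p\le t_1\le\cdots\le t_i\le q}T^n_i(t_1,\dots,t_i)\,dt_1\cdots dt_i\quad (n\ge2),$$ where $T_i^n(t_1,\dots,t_i)$ is the sum of trees of height $i$ with $n$ leaves built from the $a^k_t$, as defined in the context. Then for all $p,q\in I$ the maps $(\mathscr F^n_{p\to q})_{n\ge1}$ form an $A_\infty$ morphism from $\mathcal A_p$ to $\mathcal A_q$.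
   Context: Degrees: $|a|$ is the degree of $a\in V$; $V[k]^i=V^{i+k}$; $\mathrm{Hom}(V^{\otimes n},V[k])$ is the space of $n$-linear maps of degree $k$. A map $f\in\mathrm{Hom}(V^{\otimes n},V[1-n+k])$ has shifted degree $\|f\|=k$. Put $\epsilon_j=\sum_{i=1}^j(|a_i|-1)$. $A_\infty$ algebra (zero curvature): a graded space $V$ with maps $\mu^n\in\mathrm{Hom}(V^{\otimes n},V[2-n])$, $n\ge1$, such that for all $n\ge 1$, $\sum_{k+r=n+1}\sum_{j=0}^{k-1}(-1)^{\epsilon_j}\mu^k(a_1,\dots,a_j,\mu^r(a_{j+1},\dots,a_{j+r}),a_{j+r+1},\dots,a_n)=0$. $A_\infty$ morphism $\mathscr F:(V,\mu_{\mathcal A})\to(W,\mu_{\mathcal B})$: maps $\mathscr F^n\in\mathrm{Hom}(V^{\otimes n},W[1-n])$, $n\ge1$, such that for all $n\ge 1$, $\sum_{r}\sum_{s_1+\cdots+s_r=n}\mu^r_{\mathcal B}(\mathscr F^{s_1}(a_1,\dots),\dots,\mathscr F^{s_r}(\dots,a_n))=\sum_{m,j}(-1)^{\epsilon_j}\mathscr F^{n-m+1}(a_1,\dots,a_j,\mu^m_{\mathcal A}(a_{j+1},\dots,a_{j+m}),a_{j+m+1},\dots,a_n)$. Graded Lie algebra $\mathfrak g$: $\mathfrak g^k=\prod_{n\ge0}\mathrm{Hom}(V^{\otimes n},V[1-n+k])$ with Gerstenhaber bracket $[f,g]=f\circ g-(-1)^{\|f\|\|g\|}g\circ f$, where for $g$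 of arity $r$, $(f\circ g)(a_1,\dots)=\sum_j(-1)^{\|g\|\epsilon_j}f(a_1,\dots,a_j,g(a_{j+1},\dots,a_{j+r}),\dots)$. On $\Omega^*(I;\mathfrak g)$ the bracket is determined by $[\omega\otimes f,\theta\otimes g]=(-1)^{\|f\|\deg\theta}\,\omega\wedge\theta\otimes[f,g]$, the total degree is form degree plus degree in $\mathfrak g$, and the differential $d$ is the de Rham differential (this is the pullback along a path of a flat local system on a manifold, trivialized by its flat connection). The Maurer-Cartan equation is $d\alpha+\frac12[\alpha,\alpha]=0$ for $\alpha$ of total degree $1$; $\alpha^{m,n}$ is its component in $\Omega^m(I;\mathrm{Hom}(V^{\otimes n},V[2-m-n]))$. Thus $a_t^n\in\mathrm{Hom}(V^{\otimes n},V[1-n])$, and $\alpha^{1,1}=0$ means $a_t^1=0$. Trees: $T^1_0=\mathrm{Id}$, $T^n_0=0$ for $n\ne1$, and for $i\ge1$ $$T^n_i(t_1,\dots,t_i)=\sum_{k=1}^{n}\sum_{j=0}^{n-k}T^{n-k+1}_{i-1}(t_2,\dots,t_i)\bigl(1^{\otimes j}\otimes a^k_{t_1}\otimes1^{\otimes n-k-j}\bigr).$$ That is, a tree of height $i$ has one vertex $a_{t_l}$ on each level $l$ (identities elsewhere), with level $1$ nearest the leaves and level $i$ at the root. For $p>q$ the inequalities in the integrals are reversed; precisely, for all $p,q$ the integral means the oriented iterated integral $\int_p^q dt_i\int_p^{t_i}dt_{i-1}\cdots\int_p^{t_2}dt_1$. *)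

(* Defs.v *)
From HB Require Import structures.
From mathcomp Require Import all_boot all_order all_algebra.
From mathcomp Require Import all_classical all_reals all_analysis.
From mathcomp Require Import finmap.
Set Implicit Arguments.
Unset Strict Implicit.
Unset Printing Implicit Defensive.
Import Order.TTheory GRing.Theory Num.Theory.
Import numFieldNormedType.Exports.
Local Open Scope classical_set_scope.
Local Open Scope ring_scope.

(* A decomposition V = \bigoplus_(i : int) V_i, given by its projections; the
   sum in [gproj_sum] is a finite one by [gproj_fin]. *)
Record grading (R : realType) (V : lmodType R) := Grading {
  gproj : int -> {linear V -> V};
  gproj_idem : forall i j v,
    gproj i (gproj j v) = if i == j then gproj j v else 0;
  gproj_fin : forall v, finite_set [set i | gproj i v != 0];
  gproj_sum : forall v, v = \sum_(i \in [set: int]) gproj i v }.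

Section Multilinear.
Variable R : realType.

Definition homog (V : lmodType R) (G : grading V) (d : int) (v : V) : Prop :=
  gproj G d v = v.

Definition homog_seq (V : lmodType R) (G : grading V) (d : seq int) (a : seq V)
    : Prop :=
  size d = size a /\
  forall i, (i < size a)%N -> homog G (nth 0 d i) (nth 0 a i).

(* A function [f : seq V -> W] stands for the family of its restrictions f^n to
   sequences of size n, n >= 0; [in_hom GV GW n k f] says that
   f^n \in Hom(V^{\otimes n}, W[k]). *)
Record in_hom (V W : lmodType R) (GV : grading V) (GW : grading W)
    (n : nat) (k : int) (f : seq V -> W) : Prop := InHom {
  in_hom_linear : forall (a b : seq V) (c : R) (u v : V),
    (size a + size b).+1 = n ->
    f (a ++ (c *: u + v) :: b) = c *: f (a ++ u :: b) + f (a ++ v :: b);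
  in_hom_degree : forall (d : seq int) (a : seq V),
    size a = n -> homog_seq GV d a -> homog GW (\sum_(i <- d) i + k) (f a) }.

(* f(a_1, .., a_j, g(a_{j+1}, .., a_{j+r}), a_{j+r+1}, .., a_n) *)
Definition insert (V W : Type) (f : seq V -> W) (g : seq V -> V) (j r : nat)
    (a : seq V) : W :=
  f (take j a ++ g (take r (drop j a)) :: drop (j + r) a).

(* d is the sequence of the degrees |a_1|, |a_2|, .. *)
Definition eps (d : seq int) (j : nat) : int := \sum_(i <- take j d) (i - 1).

Definition ainf_sum (V W : lmodType R) (d : seq int) (f : seq V -> W)
    (g : seq V -> V) (a : seq V) : W :=
  \sum_(1 <= r < (size a).+1) \sum_(0 <= j < (size a - r).+1)
    ((-1) ^ eps d j : R) *: insert f g j r a.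

Record ainf_algebra (V : lmodType R) (G : grading V) (mu : seq V -> V)
    : Prop := AinfAlgebra {
  ainf_algebra_hom : forall n, (1 <= n)%N -> in_hom G G n (2 - n%:Z) mu;
  ainf_algebra_eq : forall (d : seq int) (a : seq V), (1 <= size a)%N ->
    homog_seq G d a -> ainf_sum d mu mu a = 0 }.

(* \sum_r \sum_(s_1 + .. + s_r = n) mu^r(F^{s_1}(..), .., F^{s_r}(..)), where
   [reshape s a] cuts a into consecutive blocks of sizes s_1, .., s_r. *)
Definition block_sum (V W : lmodType R) (mu : seq W -> W) (F : seq V -> W)
    (a : seq V) : W :=
  \sum_(1 <= r < (size a).+1)
    \sum_(s : r.-tuple 'I_(size a).+1 |
            all (fun i : 'I__ => 0 < i)%N s && (\sum_(i <- s) i == size a)%N)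
      mu [seq F b | b <- reshape [seq nat_of_ord i | i <- s] a].

Record ainf_morphism (V W : lmodType R) (GV : grading V) (GW : grading W)
    (muA : seq V -> V) (muB : seq W -> W) (F : seq V -> W)
    : Prop := AinfMorphism {
  ainf_morphism_source : ainf_algebra GV muA;
  ainf_morphism_target : ainf_algebra GW muB;
  ainf_morphism_hom : forall n, (1 <= n)%N -> in_hom GV GW n (1 - n%:Z) F;
  ainf_morphism_eq : forall (d : seq int) (a : seq V), (1 <= size a)%N ->
    homog_seq GV d a -> block_sum muB F a = ainf_sum d F muA a }.

End Multilinear.

Section GradedLie.
Variables (R : realType) (V : lmodType R) (G : grading V).

(* f \in g^k, i.e. ||f|| = k *)
Definition in_g (k : int) (f : seq V -> V) : Prop :=
  forall n : nat, in_hom G G n (1 - n%:Z + k) f.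

(* The linear map that is (-1)^(l (|v| - 1)) on homogeneous v. *)
Definition koszul (l : int) (v : V) : V :=
  \sum_(i \in [set: int]) ((-1) ^ (l * (i - 1)) : R) *: gproj G i v.

(* f \circ g for ||g|| = l, as a multilinear map on all of V: the factor
   (-1)^(l eps_j) is put on a_1, .., a_j (see [gcirc_homog]). The arity r of the
   inserted component of g may be 0. *)
Definition gcirc (l : int) (f g : seq V -> V) (a : seq V) : V :=
  \sum_(0 <= r < (size a).+1) \sum_(0 <= j < (size a - r).+1)
    f (map (koszul l) (take j a) ++
       g (take r (drop j a)) :: drop (j + r) a).

(* [f, g] for ||f|| = k and ||g|| = l *)
Definition gbracket (k l : int) (f g : seq V -> V) (a : seq V) : V :=
  gcirc l f g a - ((-1) ^ (k * l) : R) *: gcirc k g f a.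

Lemma koszul_homog l d v : homog G d v ->
  koszul l v = ((-1) ^ (l * (d - 1)) : R) *: v.
Proof.
move=> vd; rewrite /koszul (fsbigTE [fset d]%fset); last first.
  move=> i; rewrite inE => /negbTE nid.
  by rewrite -vd gproj_idem nid scaler0.
by rewrite big_seq_fset1 vd.
Qed.

Lemma in_hom_scale (n : nat) (k : int) f (a b : seq V) c u :
  in_hom G G n k f -> (size a + size b).+1 = n ->
  f (a ++ (c *: u) :: b) = c *: f (a ++ u :: b).
Proof.
move=> [fl _] sn.
have f0 : f (a ++ 0 :: b) = 0.
  have := fl a b (-1) 0 0 sn; rewrite scaler0 addr0 => ->.
  by rewrite scaleN1r addNr.
by have := fl a b c u 0 sn; rewrite addr0 f0 addr0.
Qed.

Lemma in_hom_koszul (n : nat) (k l : int) f (p a b : seq V) (d : seq int) :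
  in_hom G G n k f -> (size p + size a + size b)%N = n -> homog_seq G d a ->
  f (p ++ map (koszul l) a ++ b) =
  ((-1) ^ (l * \sum_(i <- d) (i - 1)) : R) *: f (p ++ a ++ b).
Proof.
move=> fh; elim: a d p => [|x a IH] [|e d] p sn [//= sd hd].
  by rewrite big_nil mulr0 expr0z scale1r.
rewrite (koszul_homog _ (hd 0 isT)) (in_hom_scale _ _ fh); last first.
  by rewrite size_cat size_map -sn /= addnS addnA addSn.
rewrite /= -!cat_rcons (IH d); last 2 first.
- by rewrite size_rcons -sn /= addnS addSn.
- by split; [case: sd | move=> i ia; exact: (hd i.+1 ia)].
by rewrite cat_rcons scalerA big_cons [l * (_ + \sum_(_ <- _) _)]mulrDr expfzDr ?oppr_eq0 ?oner_eq0.
Qed.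

Lemma gcirc_homog k l f g d a : in_g k f -> homog_seq G d a ->
  gcirc l f g a =
  \sum_(0 <= r < (size a).+1) \sum_(0 <= j < (size a - r).+1)
    ((-1) ^ (l * eps d j) : R) *: insert f g j r a.
Proof.
move=> fk [sd hd]; apply: eq_big_nat => r /andP[_ rn].
apply: eq_big_nat => j /andP[_ jn].
have ja : (j <= size a)%N by apply: leq_trans (leq_subr r _).
have := @in_hom_koszul _ _ l f [::] (take j a)
  (g (take r (drop j a)) :: drop (j + r) a) (take j d) (fk _) erefl.
rewrite !cat0s; apply; split; first by rewrite !size_take sd.
move=> i; rewrite size_takel// => ij.
by rewrite !nth_take//; apply: hd; apply: leq_trans ja.
Qed.

End GradedLie.

Section Curves.
Variables (R : realType) (V : lmodType R).

Definition smooth (phi : R -> R) : Prop :=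
  forall (n : nat) (x : R), derivable (derive1n n phi) x 1.

(* The curve \sum_k phi_k \otimes v_k of C^\infty(I) \otimes V; a smooth
   function on I = [0, 1] is the restriction of a smooth function on R. *)
Definition curve_rep (c : R -> V) (m : nat) (phi : 'I_m -> R -> R)
    (v : 'I_m -> V) : Prop :=
  (forall k, smooth (phi k)) /\
  forall t : R, 0 <= t <= 1 -> c t = \sum_(k < m) phi k t *: v k.

Definition smooth_curve (c : R -> V) : Prop :=
  exists (m : nat) (phi : 'I_m -> R -> R) (v : 'I_m -> V), curve_rep c phi v.

(* The vectors selected by [xget] in [vderive] and [vint] do not depend on the
   representation, see [vderiveE] and [vintE]. *)
Definition vderive (c : R -> V) (t : R) : V :=
  xget 0 [set w | exists (m : nat) (phi : 'I_m -> R -> R) (v : 'I_m -> V),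
    curve_rep c phi v /\ w = \sum_(k < m) derive1 (phi k) t *: v k].

Definition oint (phi : R -> R) (p q : R) : R :=
  if p <= q then \int[lebesgue_measure]_(t in `[p, q]) phi t
  else - \int[lebesgue_measure]_(t in `[q, p]) phi t.

Definition vint (c : R -> V) (p q : R) : V :=
  xget 0 [set w | exists (m : nat) (phi : 'I_m -> R -> R) (v : 'I_m -> V),
    curve_rep c phi v /\ w = \sum_(k < m) oint (phi k) p q *: v k].

Lemma derive1_comb (phi psi : R -> R) (c t : R) :
  derivable phi t 1 -> derivable psi t 1 ->
  derive1 (fun x => phi x - c * psi x) t = derive1 phi t - c * derive1 psi t.
Proof.
move=> dphi dpsi; rewrite !derive1E.
rewrite (_ : (fun x => _) = phi - c \*: psi)//.
by rewrite deriveB ?deriveZ//; exact: derivableZ.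
Qed.

Lemma smooth_comb (phi psi : R -> R) (c : R) : smooth phi -> smooth psi ->
  smooth (fun t => phi t - c * psi t).
Proof.
move=> sphi spsi n.
have -> : derive1n n (fun t => phi t - c * psi t) =
    (fun t => derive1n n phi t - c * derive1n n psi t).
  elim: n => [//|n IH]; rewrite derive1nS IH; apply/funext => t.
  by rewrite derive1_comb// -!derive1nS.
move=> x; apply: (derivableB (f := derive1n n phi)); first exact: sphi.
exact: (derivableZ (f := derive1n n psi)).
Qed.

Lemma smooth_continuous (phi : R -> R) : smooth phi -> continuous phi.
Proof.
move=> sphi x; apply: differentiable_continuous.
by apply/derivable1_diffP; exact: (sphi 0%N).
Qed.

(* A linear functional on smooth functions that only depends on the restriction
   to I extends to curves. *)
Lemma curve_rep_unique (L : (R -> R) -> R) :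
  (forall phi psi c, smooth phi -> smooth psi ->
     L (fun t => phi t - c * psi t) = L phi - c * L psi) ->
  (forall phi, smooth phi -> (forall t : R, 0 <= t <= 1 -> phi t = 0) ->
     L phi = 0) ->
  forall c m phi v m' phi' v',
    @curve_rep c m phi v -> @curve_rep c m' phi' v' ->
    \sum_(k < m) L (phi k) *: v k = \sum_(k < m') L (phi' k) *: v' k.
Proof.
move=> Llin L0.
have zero m : forall (phi : 'I_m -> R -> R) (v : 'I_m -> V),
    (forall k, smooth (phi k)) ->
    (forall t : R, 0 <= t <= 1 -> \sum_(k < m) phi k t *: v k = 0) ->
    \sum_(k < m) L (phi k) *: v k = 0.
  elim: m => [|m IH] phi v sphi phiv; first by rewrite big_ord0.
  have [[c [k0 ck0 cv]]|free] := pselect (exists c : 'I_m.+1 -> R,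
      exists2 k0, c k0 != 0 & \sum_k c k *: v k = 0).
    pose e k := c (lift k0 k) / c k0.
    have vk0 : v k0 = - \sum_(k < m) e k *: v (lift k0 k).
      apply: (scalerI ck0).
      have := cv; rewrite (bigD1_ord k0)//= => /eqP; rewrite addr_eq0 => /eqP->.
      rewrite scalerN; congr (- _); rewrite scaler_sumr; apply: eq_bigr => k _.
      by rewrite scalerA /e mulrCA divff ?mulr1.
    have red (x : 'I_m.+1 -> R) : \sum_k x k *: v k =
        \sum_(k < m) (x (lift k0 k) - e k * x k0) *: v (lift k0 k).
      rewrite (bigD1_ord k0)//= vk0 scalerN scaler_sumr -sumrN -big_split/=.
      apply: eq_bigr => k _.
      by rewrite scalerBl scalerA addrC mulrC.
    rewrite red.
    under eq_bigr => k _ do rewrite -Llin//.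
    apply: IH; first by move=> k; exact: smooth_comb.
    by move=> t tI; rewrite -(red (fun k => phi k t)) phiv.
  rewrite big1// => k _; rewrite L0 ?scale0r// => t tI.
  apply: contrapT => /eqP phik; apply: free.
  by exists (fun k => phi k t); exists k => //; exact: phiv.
move=> c m phi v m' phi' v' [sphi phiv] [sphi' phiv'].
pose psi (k : 'I_(m + m')) := match fintype.split k with
  | inl i => phi i | inr i => phi' i end.
pose w (k : 'I_(m + m')) := match fintype.split k with
  | inl i => v i | inr i => - v' i end.
have sp (x : (R -> R) -> R) : \sum_k x (psi k) *: w k =
    \sum_(k < m) x (phi k) *: v k - \sum_(k < m') x (phi' k) *: v' k.
  rewrite big_split_ord/= -sumrN; congr (_ + _); apply: eq_bigr => k _.
    by rewrite /psi /w (unsplitK (inl k)).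
  by rewrite /psi /w (unsplitK (inr k)) scalerN.
apply/eqP; rewrite -subr_eq0 -sp; apply/eqP; apply: zero.
  by move=> k; rewrite /psi; case: fintype.split.
by move=> t tI; rewrite (sp (fun f => f t)) -phiv// -phiv'// subrr.
Qed.

Lemma vderiveE (c : R -> V) m (phi : 'I_m -> R -> R) (v : 'I_m -> V) (t : R) :
  0 <= t <= 1 -> curve_rep c phi v ->
  vderive c t = \sum_(k < m) derive1 (phi k) t *: v k.
Proof.
move=> /andP[t0 t1] cphi; apply: xget_unique; first by exists m, phi, v.
move=> w [m' [phi' [v' [cphi' ->]]]].
apply: (curve_rep_unique (L := fun f => derive1 f t) _ _ cphi' cphi).
  move=> f g a sf sg.
  by rewrite derive1_comb//; [exact: (sf 0%N)|exact: (sg 0%N)].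
move=> f sf f0; have df : derivable f t 1 := sf 0%N t.
rewrite derive1E; have [t1'|t1'] := ltP t 1.
  rewrite ['D_1 f t]cvg_at_rightE//; apply: (@cvg_lim R^o) => //.
  apply: cvg_near_cst; near=> h.
  rewrite /= [f t]f0 ?t0// f0 ?subr0 ?scaler0//; apply/andP; split.
    by rewrite [h *: 1]mulr1 addr_ge0.
  rewrite [h *: 1]mulr1 -lerBrDr; near: h.
  by apply: nbhs_right_le; rewrite subr_gt0.
have t1E : t = 1 by apply/eqP; rewrite eq_le t1 t1'.
rewrite ['D_1 f t]cvg_at_leftE//; apply: (@cvg_lim R^o) => //.
apply: cvg_near_cst; near=> h.
rewrite /= [f t]f0 ?t0// f0 ?subr0 ?scaler0//; apply/andP; split.
  rewrite [h *: 1]mulr1 t1E -lerBlDr sub0r; near: h.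
  by apply: nbhs_left_ge; rewrite ltrN10.
by rewrite [h *: 1]mulr1 t1E -lerBrDr subrr; near: h; exact: nbhs_left_le.
Unshelve. all: by end_near. Qed.

Lemma smooth_integrable (phi : R -> R) (p q : R) : smooth phi ->
  lebesgue_measure.-integrable `[p, q] (EFin \o phi).
Proof.
move=> sphi; apply: continuous_compact_integrable.
  exact: segment_compact.
by apply: continuous_subspaceT; exact: smooth_continuous.
Qed.

Lemma vintE (c : R -> V) m (phi : 'I_m -> R -> R) (v : 'I_m -> V) (p q : R) :
  0 <= p <= 1 -> 0 <= q <= 1 -> curve_rep c phi v ->
  vint c p q = \sum_(k < m) oint (phi k) p q *: v k.
Proof.
move=> /andP[p0 p1] /andP[q0 q1] cphi.
apply: xget_unique; first by exists m, phi, v.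
move=> w [m' [phi' [v' [cphi' ->]]]].
apply: (curve_rep_unique (L := fun f => oint f p q) _ _ cphi' cphi).
  move=> f g a sf sg.
  have lin x y : \int[lebesgue_measure]_(t in `[x, y]) (f t - a * g t) =
      \int[lebesgue_measure]_(t in `[x, y]) f t -
      a * \int[lebesgue_measure]_(t in `[x, y]) g t.
    have fi := @smooth_integrable _ x y sf.
    have gi := @smooth_integrable _ x y sg.
    rewrite RintegralB ?RintegralZl//.
    rewrite (_ : _ \o _ = fun t => (a%:E * (EFin \o g) t)%E)//.
    exact: integrableZl.
  by rewrite /oint; case: ifP => _; rewrite lin// mulrN opprB opprK addrC.
move=> f _ f0.
have zero (x y : R) : 0 <= x -> y <= 1 ->
    \int[lebesgue_measure]_(t in `[x, y]) f t = 0.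
  move=> x0 y1; transitivity (\int[lebesgue_measure]_(t in `[x, y]) (0 : R)).
    apply: eq_Rintegral => t /set_mem; rewrite /= in_itv /= => /andP[xt ty].
    by rewrite f0// (le_trans x0 xt) (le_trans ty y1).
  by rewrite Rintegral_cst ?mul0r.
by rewrite /oint !zero// oppr0 if_same.
Qed.

(* \int_p^q dt_i \int_p^{t_i} dt_{i-1} .. \int_p^{t_2} dt_1 h [:: t_1; ..; t_i] *)
Fixpoint iint (i : nat) (h : seq R -> V) (p q : R) : V :=
  if i is i'.+1 then
    vint (fun t => iint i' (fun ts => h (rcons ts t)) p t) p q
  else h [::].

End Curves.

Section Forms.
Variables (R : realType) (V : lmodType R) (G : grading V).

(* [GForm w0 w1] stands for w0 + dt \otimes w1 in \Omega^*(I; g); only the values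
   at t in [0, 1] matter. *)
Record gform := GForm {
  form0 : R -> seq V -> V;
  form1 : R -> seq V -> V }.

(* w is a form of total degree k *)
Record in_forms (k : int) (w : gform) : Prop := InForms {
  form0_deg : forall t : R, 0 <= t <= 1 -> in_g G k (form0 w t);
  form1_deg : forall t : R, 0 <= t <= 1 -> in_g G (k - 1) (form1 w t);
  form0_smooth : forall a, smooth_curve (fun t => form0 w t a);
  form1_smooth : forall a, smooth_curve (fun t => form1 w t a) }.

Definition dform (w : gform) : gform :=
  GForm (fun _ _ => 0) (fun t a => vderive (fun s => form0 w s a) t).

(* [w, z] for w, z of total degrees k, l, from
   [om \otimes f, th \otimes g] =
     (-1)^(||f|| deg th) om /\ th \otimes [f, g];
   the sign is nontrivial only for om = 1, th = dt. *)
Definition fbracket (k l : int) (w z : gform) : gform :=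
  GForm (fun t => gbracket G k l (form0 w t) (form0 z t))
       (fun t a => ((-1) ^ k : R) *:
            gbracket G k (l - 1) (form0 w t) (form1 z t) a
          + gbracket G (k - 1) l (form1 w t) (form0 z t) a).

Definition maurer_cartan (w : gform) : Prop :=
  in_forms 1 w /\
  forall (t : R) (a : seq V), 0 <= t <= 1 ->
    form0 (dform w) t a + (2^-1 : R) *: form0 (fbracket 1 1 w w) t a = 0 /\
    form1 (dform w) t a + (2^-1 : R) *: form1 (fbracket 1 1 w w) t a = 0.

End Forms.

Section Trees.
Variables (R : realType) (V : lmodType R).

(* T^n_i(t_1, .., t_i), for n the size of x and ts = [:: t_1; ..; t_i] *)
Fixpoint tree (at_ : R -> seq V -> V) (ts : seq R) (x : seq V) : V :=
  if ts is t :: ts' then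
    \sum_(1 <= k < (size x).+1) \sum_(0 <= j < (size x - k).+1)
      insert (tree at_ ts') (at_ t) j k x
  else if x is [:: v] then v else 0.

(* F^n_{p -> q}, for n the size of x *)
Definition ainf_transport (at_ : R -> seq V -> V) (p q : R) (x : seq V) : V :=
  if x is [:: v] then v else
  \sum_(1 <= i < size x)
    ((-1) ^+ i : R) *: iint i (fun ts => tree at_ ts x) p q.

End Trees.

(* Main.v *)
(** Fix q and let p vary. Differentiating the iterated integrals in their lower
    bound p gives F_p' = F_p \circ a_p, where \circ a_p inserts a_p in all
    possible ways. The Maurer-Cartan equation reads
    mu' = mu \circ a - a \circ mu, so by the Leibniz rule and the pre-Lie
    identity the defect E_p = mu_q(F_p, .., F_p) - F_p \circ mu_p satisfies the
    same linear equation E_p' = E_p \circ a_p. As a has no components of arity 0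
    and 1, the right-hand side only involves E_p on fewer inputs; since E_q = 0,
    it vanishes by induction on the number of inputs. *)
Require Import Defs.
From mathcomp Require Import all_boot all_order all_algebra.
From mathcomp Require Import all_classical all_reals all_analysis.
From mathcomp Require Import ring lra zify.
Set Implicit Arguments.
Unset Strict Implicit.
Unset Printing Implicit Defensive.
Import Order.TTheory GRing.Theory Num.Theory.
Import numFieldNormedType.Exports.
Local Open Scope classical_set_scope.
Local Open Scope ring_scope.

(** The vertex carrying t_1 sits next to the leaves, exactly where the recursion for trees peels it
    off, so differentiating in p reproduces that recursion. Differentiating in q would expose the
    root instead, and the integrals over the forest below it would have to be regrouped into
    products of transports by shuffling variables. The price is that p is a bound of every nested
    integral; reversing the order of integration leaves it in the outermost one only. V has no
    topology, so all analysis is done on the scalar coefficients of finite representations of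
    curves. Signs are carried by the operator [koszul G 1] applied to the inputs on the left. Since
    a has shifted degree 0, it commutes with this operator on homogeneous inputs, which is what the
    pre-Lie identity requires. *)

(** * Scalar calculus: smooth functions and oriented integrals *)

Section Smooth.
Variable R : realType.
Implicit Types f g : R -> R.

(** Peeling off the innermost derivative lets closure under products follow from a single use of the
    product rule, without a formula for n-th derivatives. *)
Fixpoint nsmooth (n : nat) f : Prop :=
  (forall x : R, derivable f x 1) /\
  if n is n'.+1 then nsmooth n' (derive1 f) else True.

Lemma nsmoothP f : smooth f <-> forall n, nsmooth n f.
Proof.
split=> [sf n|sf n x].
  elim: n f sf => [|n IH] f sf /=; first by split=> //; exact: (sf 0%N).
  split; first exact: (sf 0%N).
  by apply: IH => m x; rewrite -derive1Sn; exact: sf.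
have := sf n; elim: n f {sf} => [|n IH] f [df nf]; first exact: df.
by rewrite derive1Sn; exact: IH.
Qed.

Lemma nsmoothW n f : nsmooth n.+1 f -> nsmooth n f.
Proof. by elim: n f => [|n IH] f /= [df nf]; split=> //; exact: IH. Qed.

Lemma derive1D f g : (forall x : R, derivable f x 1) ->
  (forall x : R, derivable g x 1) ->
  derive1 (fun x => f x + g x) = (fun x => derive1 f x + derive1 g x).
Proof.
move=> df dg; apply/funext => x; rewrite !derive1E.
by rewrite (_ : (fun x => _) = f + g)// deriveD.
Qed.

Lemma derive1M f g : (forall x : R, derivable f x 1) ->
  (forall x : R, derivable g x 1) ->
  derive1 (fun x => f x * g x) =
  (fun x => derive1 f x * g x + f x * derive1 g x).
Proof.
move=> df dg; apply/funext => x; rewrite !derive1E.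
rewrite (_ : (fun x => _) = f * g)// deriveM// addrC.
by rewrite [g x *: _]mulrC.
Qed.

Lemma nsmoothD n f g : nsmooth n f -> nsmooth n g ->
  nsmooth n (fun x => f x + g x).
Proof.
elim: n f g => [|n IH] f g /= [df nf] [dg ng]; split=> // ;
  try (by move=> x; exact: derivableD).
by rewrite derive1D//; exact: IH.
Qed.

Lemma nsmoothM n f g : nsmooth n f -> nsmooth n g ->
  nsmooth n (fun x => f x * g x).
Proof.
elim: n f g => [|n IH] f g sf sg.
  by split=> // x; apply: derivableM; [case: sf|case: sg].
have [df nf] := sf; have [dg ng] := sg; split.
  by move=> x; exact: derivableM.
rewrite derive1M//.
by apply: nsmoothD; apply: IH => //; exact: nsmoothW.
Qed.

Lemma smooth_derivable f x : smooth f -> derivable f x 1.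
Proof. by move=> sf; exact: (sf 0%N). Qed.

Lemma smoothD f g : smooth f -> smooth g -> smooth (fun x => f x + g x).
Proof. by move=> /nsmoothP sf /nsmoothP sg; apply/nsmoothP => n; exact: nsmoothD. Qed.

Lemma smoothM f g : smooth f -> smooth g -> smooth (fun x => f x * g x).
Proof. by move=> /nsmoothP sf /nsmoothP sg; apply/nsmoothP => n; exact: nsmoothM. Qed.

Lemma smooth_cst (c : R) : smooth (fun=> c).
Proof.
move=> n x; elim: n c => [|n IH] c; first exact: derivable_cst.
have -> : derive1n n.+1 (fun=> c) = derive1n n (fun=> 0 : R).
  rewrite derive1Sn; congr (derive1n n _); apply/funext => y.
  by rewrite derive1E derive_cst.
exact: IH.
Qed.

Lemma smooth_derive1 f : smooth f -> smooth (derive1 f).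
Proof. by move=> sf n x; rewrite -derive1Sn; exact: (sf n.+1). Qed.

Lemma smooth_of_derive1 f g : (forall x : R, derivable f x 1) ->
  derive1 f = g -> smooth g -> smooth f.
Proof.
move=> df <- sg [|n] x; first exact: df.
by rewrite derive1Sn; exact: sg.
Qed.

Lemma derive1MD f g t : smooth f -> smooth g ->
  derive1 (fun x => f x * g x) t = derive1 f t * g t + f t * derive1 g t.
Proof. by move=> sf sg; rewrite derive1M// => x; exact: smooth_derivable. Qed.

Lemma derive1B_cst f (c x : R) : derivable f x 1 ->
  derivable (fun y => f y - c) x 1 /\
  derive1 (fun y => f y - c) x = derive1 f x.
Proof.
move=> df; have dc : derivable (cst c : R -> R) x 1 by exact: derivable_cst.
split; first exact: (derivableB df dc).
rewrite !derive1E (_ : (fun y => _) = f - cst c)// deriveB//.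
by rewrite derive_cst subr0.
Qed.

Lemma oint_sub f (a p q : R) : smooth f -> a <= p -> a <= q ->
  oint f p q = \int[lebesgue_measure]_(t in `[a, q]) f t
    - \int[lebesgue_measure]_(t in `[a, p]) f t.
Proof.
move=> sf; rewrite /oint.
have sub x y : a <= x -> x <= y ->
    \int[lebesgue_measure]_(t in `[x, y]) f t =
    \int[lebesgue_measure]_(t in `[a, y]) f t
    - \int[lebesgue_measure]_(t in `[a, x]) f t.
  move=> ax xy; have fi := @smooth_integrable _ f a y sf.
  rewrite Rintegral_itvB ?bnd_simp//= Rintegral_itv_obnd_cbnd//.
  by apply: integrableS fi => //; apply: subset_itvr; rewrite bnd_simp.
move=> ap aq; case: (leP p q) => [pq|/ltW qp]; first exact: sub.
by rewrite sub// opprB.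
Qed.

Definition primitive f (t : R) : R := oint f 0 t.

Lemma primitive_derive f x : smooth f ->
  derivable (primitive f) x 1 /\ derive1 (primitive f) x = f x.
Proof.
(* A base point strictly to the left of 0 and x: x is then interior to the interval of integration,
   and near x the oriented integral from 0 is a difference of integrals from [a]. *)
move=> sf; pose a := Num.min 0 x - 1.
have a0 : a <= 0 by rewrite lerBlDr ge_min ler_wpDl// ler01.
have ax : a < x by rewrite ltrBlDr gt_min (ltr_pwDr _ (lexx x))// orbT.
have x1 : x < x + 1 by rewrite ltrDl.
have [dF F'] := @continuous_FTC1_closed _ f a x _ x1
  (@smooth_integrable _ f a (x + 1) sf) ax (@smooth_continuous _ f sf x).
pose F := fun y => \int[lebesgue_measure]_(t in `[a, y]) f t.
have near_eq : \forall y \near x, F y - F 0 = primitive f y.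
  near=> y; rewrite /primitive (oint_sub (a := a))//; near: y.
  exact: lt_le_nbhsr.
have [dG G'] := derive1B_cst (F 0) dF.
split; first exact: near_eq_derivable near_eq dG.
by rewrite derive1E -(near_eq_derive _ near_eq) -derive1E G'.
Unshelve. all: by end_near. Qed.

Lemma primitive_smooth f : smooth f -> smooth (primitive f).
Proof.
move=> sf; apply: (smooth_of_derive1 (g := f)) => //.
  by move=> x; case: (primitive_derive x sf).
by apply/funext => x; case: (primitive_derive x sf).
Qed.

(** One [F] serves both orders of the endpoints, so no case distinction on p <= q is needed
    later. *)
Lemma antiderivative f : smooth f -> exists F, [/\ smooth F, derive1 F = f &
  forall p q, oint f p q = F q - F p].
Proof.
move=> sf; exists (primitive f); split; first exact: primitive_smooth.
  by apply/funext => x; case: (primitive_derive x sf).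
move=> p q; pose a := Num.min 0 (Num.min p q).
have [a0 ap aq] : [/\ a <= 0, a <= p & a <= q].
  by rewrite /a !ge_min !lexx !orbT.
by rewrite /primitive !(oint_sub (a := a))// opprB addrA subrK.
Qed.

Lemma smooth_derive0_const f (p q : R) : smooth f ->
  (forall x, derive1 f x = 0) -> f p = f q.
Proof.
move=> sf f'0.
have ic (x : R) : is_derive x 1 f 0.
  apply: DeriveDef; first exact: smooth_derivable.
  by rewrite -derive1E.
exact: is_derive_0_is_cst.
Qed.

Lemma oint_derive1 f (p q : R) : smooth f -> oint (derive1 f) p q = f q - f p.
Proof.
move=> sf; have [F [sF F' ->]] := antiderivative (smooth_derive1 sf).
(* The factor 1 gives the difference the shape expected by [smooth_comb] and [derive1_comb]. *)
have sg : smooth (fun x => F x - 1 * f x) by exact: smooth_comb.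
have : F p - 1 * f p = F q - 1 * f q.
  apply: (smooth_derive0_const p q sg) => x.
  by rewrite derive1_comb ?F' ?mul1r ?subrr//; exact: smooth_derivable.
rewrite !mul1r => E.
lra.
Qed.

End Smooth.

(** * Sums over the ways to cut a sequence into consecutive pieces *)

Section Splittings.
Variables (T : Type) (Z : zmodType).
Implicit Types (x u v w : seq T) (h : seq T -> seq T -> Z)
  (g : seq T -> seq T -> seq T -> Z).

(** This is the deconcatenation coproduct. Reindexing nested insertions then amounts to
    coassociativity and exchange of sums instead of arithmetic on positions. *)
Definition dec x h : Z := \sum_(i < (size x).+1) h (take i x) (drop i x).

Definition ins x (h : seq T -> seq T -> seq T -> Z) : Z :=
  dec x (fun u y => dec y (h u)).

Lemma dec_nil h : dec [::] h = h [::] [::].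
Proof. by rewrite /dec big_ord1. Qed.

Lemma dec_cons b x h :
  dec (b :: x) h = h [::] (b :: x) + dec x (fun u => h (b :: u)).
Proof. by rewrite /dec big_ord_recl. Qed.

Lemma eq_dec x h h' : (forall u v, x = u ++ v -> h u v = h' u v) ->
  dec x h = dec x h'.
Proof. by move=> e; apply: eq_bigr => i _; apply: e; rewrite cat_take_drop. Qed.

Lemma decD x h h' : dec x (fun u v => h u v + h' u v) = dec x h + dec x h'.
Proof. exact: big_split. Qed.

Lemma decN x h : dec x (fun u v => - h u v) = - dec x h.
Proof. exact: sumrN. Qed.

Lemma dec0 x : dec x (fun _ _ => 0) = 0.
Proof. by rewrite /dec big1. Qed.

Lemma dec_exchange x y (h : seq T -> seq T -> seq T -> seq T -> Z) :
  dec x (fun u v => dec y (h u v)) = dec y (fun u' v' => dec x (fun u v => h u v u' v')).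
Proof. exact: exchange_big. Qed.

Lemma dec_coassoc x (h : seq T -> seq T -> seq T -> Z) :
  dec x (fun y w => dec y (fun u v => h u v w)) = ins x h.
Proof.
rewrite /ins; elim: x h => [|b x IH] h; first by rewrite !dec_nil.
rewrite !dec_cons dec_nil -addrA; congr (_ + _).
under eq_dec do rewrite dec_cons.
by rewrite decD IH.
Qed.

Lemma dec_cat u b w h : dec (u ++ b :: w) h =
  dec u (fun u1 u2 => h u1 (u2 ++ b :: w)) +
  dec w (fun w1 w2 => h (u ++ b :: w1) w2).
Proof.
elim: u h => [|c u IH] h /=; first by rewrite dec_cons dec_nil.
by rewrite !dec_cons IH addrA.
Qed.

Lemma eq_ins x g g' : (forall u v w, x = u ++ v ++ w -> g u v w = g' u v w) ->
  ins x g = ins x g'.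
Proof.
by move=> e; apply: eq_dec => u y xE; apply: eq_dec => v w yE; apply: e; rewrite -yE.
Qed.

Lemma insD x g g' :
  ins x (fun u v w => g u v w + g' u v w) = ins x g + ins x g'.
Proof. by rewrite /ins -decD; apply: eq_dec => u y _; rewrite decD. Qed.

Lemma insN x g : ins x (fun u v w => - g u v w) = - ins x g.
Proof. by rewrite /ins -decN; apply: eq_dec => u y _; rewrite decN. Qed.

Lemma ins0 x : ins x (fun _ _ _ => 0) = 0.
Proof. by rewrite /ins; under eq_dec do rewrite dec0; rewrite dec0. Qed.

Lemma ins_cat u b w g : ins (u ++ b :: w) g =
  ins u (fun u1 u2 u3 => g u1 u2 (u3 ++ b :: w)) +
  dec u (fun u1 u2 => dec w (fun w1 w2 => g u1 (u2 ++ b :: w1) w2)) +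
  ins w (fun w1 w2 w3 => g (u ++ b :: w1) w2 w3).
Proof.
rewrite /ins dec_cat; congr (_ + _); rewrite -decD.
by apply: eq_dec => u1 u2 _; rewrite dec_cat.
Qed.

(* Both sides are sums over all x = u1 ++ u2 ++ u3 ++ v ++ w. *)
Lemma ins_ins x (h : seq T -> seq T -> seq T -> seq T -> seq T -> Z) :
  ins x (fun u v w => ins u (fun u1 u2 u3 => h u1 u2 u3 v w)) =
  ins x (fun u1 u2 w => ins w (fun u3 v w' => h u1 u2 u3 v w')).
Proof.
rewrite /ins.
transitivity (ins x (fun u1 y z =>
    dec y (fun u2 u3 => dec z (fun v w => h u1 u2 u3 v w)))).
  rewrite -dec_coassoc; apply: eq_dec => u z _.
  rewrite dec_exchange /ins; apply: eq_dec => u1 y _.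
  by rewrite dec_exchange.
rewrite /ins; apply: eq_dec => u1 y _.
by rewrite (dec_coassoc _ (fun u2 u3 z => dec z (fun v w => h u1 u2 u3 v w))).
Qed.

(* Both sides are sums over all x = u1 ++ u2 ++ v ++ w1 ++ w2. *)
Lemma ins_nested x (h : seq T -> seq T -> seq T -> seq T -> seq T -> Z) :
  ins x (fun u v w => dec u (fun u1 u2 => dec w (fun w1 w2 => h u1 u2 v w1 w2))) =
  ins x (fun u1 y w2 => ins y (fun u2 v w1 => h u1 u2 v w1 w2)).
Proof.
rewrite /ins.
transitivity (ins x (fun u1 u2 y =>
    dec y (fun v w => dec w (fun w1 w2 => h u1 u2 v w1 w2)))).
  rewrite -dec_coassoc; apply: eq_dec => u y _.
  by rewrite dec_exchange.
rewrite /ins; apply: eq_dec => u1 y _.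
rewrite (dec_coassoc y (fun u2 z w2 => dec z (fun v w1 => h u1 u2 v w1 w2))).
by apply: eq_dec => u2 z _; rewrite dec_coassoc.
Qed.

(** The pairs (r, j) on the left are those with j + r at most [size x]; the inner range is widened
    so that the two sums can be exchanged, and narrowed again afterwards. *)
Lemma sum_ins x g :
  \sum_(0 <= r < (size x).+1) \sum_(0 <= j < (size x - r).+1)
    g (take j x) (take r (drop j x)) (drop (j + r) x) = ins x g.
Proof.
rewrite /ins /dec big_mkord.
under eq_bigr => r _.
  rewrite (big_nat_widen _ _ (size x).+1) ?ltnS ?leq_subr// big_mkord.
  over.
rewrite (exchange_big_dep xpredT)//=; apply: eq_bigr => j _.
rewrite size_drop [RHS](big_ord_widen (size x).+1 (fun r =>
  g (take j x) (take r (drop j x)) (drop r (drop j x)))) ?ltnS ?leq_subr//.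
apply: eq_big => r; last by move=> _; rewrite drop_drop addnC.
by rewrite !ltnS !leq_subRL ?leq_ord// addnC.
Qed.

Lemma sum1_ins x g : (forall u w, g u [::] w = 0) ->
  \sum_(1 <= r < (size x).+1) \sum_(0 <= j < (size x - r).+1)
    g (take j x) (take r (drop j x)) (drop (j + r) x) = ins x g.
Proof.
move=> g0; rewrite -sum_ins [RHS]big_ltn// [X in _ = X + _]big1 ?add0r// => j _.
by rewrite take0 g0.
Qed.

Lemma dec_left x h : (forall b u v, h (b :: u) v = 0) -> dec x h = h [::] x.
Proof.
move=> h0; case: x => [|b x]; first by rewrite dec_nil.
by rewrite dec_cons; under eq_dec do rewrite h0; rewrite dec0 addr0.
Qed.

Lemma dec_right x h : (forall u b v, h u (b :: v) = 0) -> dec x h = h x [::].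
Proof.
elim: x h => [|b x IH] h h0; first by rewrite dec_nil.
by rewrite dec_cons h0 add0r IH.
Qed.

Lemma ins_dec_left x (h : seq T -> seq T -> seq T -> seq T -> Z) :
  ins x (fun u v w => dec u (fun u1 u2 => h u1 u2 v w)) =
  dec x (fun u1 z => ins z (h u1)).
Proof.
transitivity (dec x (fun u y => dec u (fun u1 u2 => dec y (h u1 u2)))).
  by apply: eq_dec => u y _; rewrite dec_exchange.
by rewrite dec_coassoc.
Qed.

Lemma ins_dec_right x (h : seq T -> seq T -> seq T -> seq T -> Z) :
  ins x (fun u v w => dec w (h u v)) =
  dec x (fun y w2 => ins y (fun u v w1 => h u v w1 w2)).
Proof.
rewrite (dec_coassoc x (fun u z w2 => dec z (fun v w1 => h u v w1 w2))).
by apply: eq_dec => u y _; rewrite dec_coassoc.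
Qed.

End Splittings.

Lemma dec_map (T T' : Type) (Z : zmodType) (k : T -> T') x
    (h : seq T' -> seq T' -> Z) :
  dec (map k x) h = dec x (fun u v => h (map k u) (map k v)).
Proof. by rewrite /dec size_map; apply: eq_bigr => i _; rewrite map_take map_drop. Qed.

Lemma ins_map (T T' : Type) (Z : zmodType) (k : T -> T') x
    (h : seq T' -> seq T' -> seq T' -> Z) :
  ins (map k x) h = ins x (fun u v w => h (map k u) (map k v) (map k w)).
Proof. by rewrite /ins dec_map; apply: eq_dec => u y _; rewrite dec_map. Qed.

(** * Multilinear maps, Gerstenhaber insertion and the pre-Lie identity *)

Section Insertions.
Variables (R : realType) (V : lmodType R).
Implicit Types (f g m a : seq V -> V) (k : V -> V) (u v w x : seq V).

Definition multilinear f : Prop := forall u w (c : R) (y z : V),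
  f (u ++ (c *: y + z) :: w) = c *: f (u ++ y :: w) + f (u ++ z :: w).

Definition vanishes_at0 f : Prop := forall u w, f (u ++ 0 :: w) = 0.

Definition circ0 f a x : V := ins x (fun u v w => f (u ++ a v :: w)).

(* The Gerstenhaber insertion in which the sign operator k acts on the inputs
   preceding g; [circ0] is the sign-free case of an inserted map of degree 0. *)
Definition circ k f g x : V := ins x (fun u v w => f (map k u ++ g v :: w)).

Lemma multilinear0 f : multilinear f -> vanishes_at0 f.
Proof.
move=> fl u w; have := fl u w (-1) 0 0.
by rewrite scaler0 addr0 scaleN1r addNr.
Qed.

Lemma multilinearD f u w y z : multilinear f ->
  f (u ++ (y + z) :: w) = f (u ++ y :: w) + f (u ++ z :: w).
Proof. by move=> fl; rewrite -[y in LHS]scale1r fl scale1r. Qed.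

Lemma multilinearZ f u w c y : multilinear f ->
  f (u ++ (c *: y) :: w) = c *: f (u ++ y :: w).
Proof. by move=> fl; rewrite -[c *: y]addr0 fl multilinear0// addr0. Qed.

Lemma multilinearN f u w y : multilinear f ->
  f (u ++ (- y) :: w) = - f (u ++ y :: w).
Proof. by move=> fl; rewrite -scaleN1r multilinearZ// scaleN1r. Qed.

Lemma sum_linear (L : V -> V) (I : Type) (r : seq I) (F : I -> V) :
  (forall c y z, L (c *: y + z) = c *: L y + L z) ->
  L (\sum_(i <- r) F i) = \sum_(i <- r) L (F i).
Proof.
move=> Llin; have L0 : L 0 = 0.
  by have := Llin (-1) 0 0; rewrite scaler0 addr0 scaleN1r addNr.
elim: r => [|i r IH]; first by rewrite !big_nil L0.
by rewrite !big_cons -[F i in LHS]scale1r Llin scale1r IH.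
Qed.

Lemma linear_ins (L : V -> V) x h :
  (forall c y z, L (c *: y + z) = c *: L y + L z) ->
  L (ins x h) = ins x (fun u v w => L (h u v w)).
Proof.
move=> Llin; rewrite /ins /dec sum_linear//.
by apply: eq_bigr => i _; rewrite sum_linear.
Qed.

Lemma multilinear_ins f u w x h : multilinear f ->
  f (u ++ (ins x h) :: w) = ins x (fun p q r => f (u ++ h p q r :: w)).
Proof.
move=> fl; apply: (linear_ins (L := fun y => f (u ++ y :: w))) => c y z.
exact: fl.
Qed.

Lemma multilinear_cat f u : multilinear f -> multilinear (fun w => f (u ++ w)).
Proof. by move=> fl v w c y z; rewrite !catA fl. Qed.

Lemma ins_linear x (c : R) (h h' : seq V -> seq V -> seq V -> V) :
  ins x (fun u v w => c *: h u v w + h' u v w) = c *: ins x h + ins x h'.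
Proof.
rewrite insD; congr (_ + _); rewrite /ins /dec scaler_sumr.
by apply: eq_bigr => i _; rewrite scaler_sumr.
Qed.

Lemma ins_sum x (I : Type) (r : seq I) (c : I -> R)
    (h : I -> seq V -> seq V -> seq V -> V) :
  ins x (fun u v w => \sum_(i <- r) c i *: h i u v w) =
  \sum_(i <- r) c i *: ins x (h i).
Proof.
elim: r => [|i r IH].
  by rewrite big_nil -[RHS](ins0 _ x); apply: eq_ins => u v w _; rewrite big_nil.
rewrite big_cons -IH -ins_linear.
by apply: eq_ins => u v w _; rewrite big_cons.
Qed.

Lemma dec_linear x (c : R) (h h' : seq V -> seq V -> V) :
  dec x (fun u v => c *: h u v + h' u v) = c *: dec x h + dec x h'.
Proof. by rewrite decD; congr (_ + _); rewrite /dec scaler_sumr. Qed.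

Lemma multilinear_circ0 f a : multilinear f -> multilinear a ->
  multilinear (circ0 f a).
Proof.
move=> fl al u w c y z; rewrite /circ0 !ins_cat.
rewrite !scalerDr [RHS]addrACA [X in _ = X + _]addrACA -!ins_linear -dec_linear.
congr (_ + _ + _).
- by apply: eq_ins => u1 u2 u3 _; rewrite -!cat_cons !catA fl.
- apply: eq_dec => u1 u2 _; rewrite -dec_linear; apply: eq_dec => w1 w2 _.
  by rewrite al fl.
- by apply: eq_ins => w1 w2 w3 _; rewrite -!catA /= fl.
Qed.

Lemma circ_vanishes_at0 k f g : k 0 = 0 -> vanishes_at0 f -> vanishes_at0 g ->
  vanishes_at0 (circ k f g).
Proof.
move=> k0 f0 g0 u w; rewrite /circ ins_cat.
rewrite (eq_ins (g' := fun _ _ _ => 0)) ?ins0; last first.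
  by move=> u1 u2 u3 _; rewrite -cat_cons catA f0.
rewrite (eq_dec (h' := fun _ _ => 0)) ?dec0; last first.
  by move=> u1 u2 _; under eq_dec do rewrite g0 f0; rewrite dec0.
rewrite (eq_ins (g' := fun _ _ _ => 0)) ?ins0 ?addr0//.
by move=> w1 w2 w3 _; rewrite map_cat /= k0 -catA f0.
Qed.

(* The pre-Lie identity
     (f \circ a) \circ m - f \circ (a \circ m)
       = (f \circ m) \circ a - f \circ (m \circ a)
   for a of degree 0. *)
Lemma circ_preLie k f m a x : multilinear f ->
  (forall u v w, x = u ++ v ++ w -> k (a v) = a (map k v)) ->
  circ k (circ0 f a) m x +
    circ k f (fun v => circ0 m a v - circ k a m v) x =
  circ0 (circ k f m) a x.
Proof.
move=> fl ka; rewrite /circ /circ0.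
have -> : ins x (fun u v w => f (map k u ++ (circ0 m a v - circ k a m v) :: w)) =
    ins x (fun u v w => ins v (fun p q r => f (map k u ++ m (p ++ a q :: r) :: w)))
  - ins x (fun u v w => ins v (fun p q r =>
      f (map k u ++ a (map k p ++ m q :: r) :: w))).
  rewrite -insN -insD; apply: eq_ins => u v w _.
  by rewrite multilinearD// multilinearN// !multilinear_ins.
under eq_ins do rewrite ins_cat ins_map dec_map.
under [in RHS]eq_ins do rewrite ins_cat.
rewrite !insD ins_ins ins_nested [in RHS]ins_ins [in RHS]ins_nested.
(* In X, Y, Z the map a stands before, around and after m; in W it stands inside m. The term Y
   occurs with both signs, and X and X' agree because k commutes with a. *)
have cancel (X Y Z W X' Z' : V) : X = X' -> Z = Z' ->
    X + Y + Z + (W - Y) = Z' + W + X'.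
  move=> -> ->; rewrite addrC [X' + Y]addrC -[Y + _ + _]addrA subrKA.
  by rewrite [X' + _]addrC addrA [W + _]addrC.
apply: cancel.
  apply: eq_ins => u y w xE; apply: eq_ins => v1 v2 v3 _.
  by rewrite map_cat -catA /= (ka u y w).
by apply: eq_ins => u y w _; apply: eq_ins => v1 v2 v3 _; rewrite -catA.
Qed.

End Insertions.

(** * The sum over compositions of the inputs, by recursion on the number of blocks *)

Section Blocks.
Variables (R : realType) (V : lmodType R) (F : seq V -> V).
Implicit Types (f : seq V -> V) (u v w x : seq V).

(* Unlike in [block_sum], blocks may be empty; these do not contribute when
   F [::] = 0. *)
Fixpoint blocks (r : nat) f x : V :=
  if r is r'.+1 then dec x (fun y => blocks r' (fun s => f (F y :: s)))
  else if x is [::] then f [::] else 0.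

Lemma eq_blocks r f f' x : f =1 f' -> blocks r f x = blocks r f' x.
Proof. by move=> /funext ->. Qed.

Lemma blocks_linear r (c : R) f f' x :
  blocks r (fun s => c *: f s + f' s) x = c *: blocks r f x + blocks r f' x.
Proof.
elim: r f f' x => [|r IH] f f' x /=.
  by case: x => [//|b x]; rewrite scaler0 addr0.
by under eq_dec do rewrite IH; rewrite dec_linear.
Qed.

Lemma blocks0 r x : blocks r (fun=> 0) x = 0.
Proof.
elim: r x => [|r IH] x /=; first by case: x.
by under eq_dec do rewrite IH; rewrite dec0.
Qed.

Lemma blocks_vanishes_at0 r f : vanishes_at0 F -> vanishes_at0 f ->
  vanishes_at0 (blocks r f).
Proof.
move=> F0; elim: r f => [|r IH] f f0 u w /=; first by case: u.
rewrite dec_cat (eq_dec (h' := fun _ _ => 0)) ?dec0 ?add0r; last first.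
  by move=> u1 u2 _; apply: IH => u' w'; rewrite -cat_cons f0.
rewrite (eq_dec (h' := fun _ _ => 0)) ?dec0// => w1 w2 _.
rewrite -[RHS](blocks0 r w2); apply: eq_blocks => s.
by rewrite F0 (f0 [::]).
Qed.

Hypothesis F_nil : F [::] = 0.

(** Split off the head of the tuple as the size of the first block. Size 0 is excluded on the left
    and contributes nothing on the right, as F [::] = 0; a size beyond [size x] is excluded by the
    total. [N] is independent of [size x] since x shrinks in the induction while the ordinal type
    stays. *)
Lemma sum_tuple_blocks (N r : nat) f x : vanishes_at0 f -> (size x <= N)%N ->
  \sum_(s : r.-tuple 'I_N.+1 |
      all (fun i : 'I__ => 0 < i)%N s && (\sum_(i <- s) i == size x)%N)
    f [seq F b | b <- reshape [seq nat_of_ord i | i <- s] x] = blocks r f x.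
Proof.
elim: r f x => [|r IH] f x f0 xN.
  rewrite big_mkcond (big_pred1 [tuple]); last first.
    by move=> s; apply/esym/eqP; rewrite tuple0.
  by rewrite big_nil /=; case: x {xN}.
have cons_bij : bijective (fun p : 'I_N.+1 * r.-tuple 'I_N.+1 =>
    cons_tuple p.1 p.2).
  exists (fun s : r.+1.-tuple 'I_N.+1 => (thead s, behead_tuple s)).
    by case=> i s; congr (_, _); apply: val_inj.
  by move=> s; apply: val_inj; case/tupleP: s => i s /=; rewrite theadE.
rewrite (reindex _ (onW_bij _ cons_bij)) big_mkcond.
pose g (i : 'I_N.+1) (s : r.-tuple 'I_N.+1) :=
  if all (fun i : 'I__ => 0 < i)%N (i :: s) && (\sum_(i <- i :: s) i == size x)%N
  then f [seq F b | b <- reshape [seq nat_of_ord i | i <- i :: s] x] else 0.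
rewrite -(pair_bigA _ g) /= /dec (big_ord_widen N.+1 (fun i => blocks r
  (fun s => f (F (take i x) :: s)) (drop i x))) ?ltnS// [RHS]big_mkcond.
apply: eq_bigr => i _; rewrite /g /= -big_mkcond /= ltnS.
have [i0|ipos] := posnP i.
  rewrite big_pred0//.
  rewrite i0 take0 F_nil -[LHS](blocks0 r (drop 0 x)); apply: eq_blocks => s.
  by rewrite (f0 [::]).
have [ix|xi] := leqP i (size x); last first.
  rewrite big_pred0// => s; rewrite big_cons gtn_eqF ?andbF//.
  by rewrite (leq_trans xi)// leq_addr.
rewrite -IH; last 2 first.
- by move=> u w; rewrite -cat_cons f0.
- by rewrite size_drop (leq_trans (leq_subr _ _)).
apply: eq_bigl => s; rewrite big_cons size_drop /=.
by rewrite -[in RHS](eqn_add2l i) subnKC.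
Qed.

Lemma block_sum_blocks f x : vanishes_at0 f ->
  block_sum f F x = \sum_(1 <= r < (size x).+1) blocks r f x.
Proof. by move=> f0; apply: eq_bigr => r _; exact: sum_tuple_blocks. Qed.

End Blocks.

(** * Differentiating curves in V *)

Section CurveCalculus.
Variables (R : realType) (V : lmodType R).
Implicit Types (c : R -> V) (t p q : R).

Lemma curve_rep_fin (T : finType) (phi : T -> R -> R) (v : T -> V) c :
  (forall k, smooth (phi k)) ->
  (forall t, 0 <= t <= 1 -> c t = \sum_k phi k t *: v k) ->
  curve_rep c (fun k : 'I_#|T| => phi (enum_val k)) (fun k => v (enum_val k)).
Proof.
move=> sphi cE; split=> [k|t tI]; first exact: sphi.
by rewrite cE// (reindex _ (onW_bij _ (enum_val_bij T))).
Qed.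

Lemma vint_fin (T : finType) (phi : T -> R -> R) (v : T -> V) c p q :
  (forall k, smooth (phi k)) ->
  (forall t, 0 <= t <= 1 -> c t = \sum_k phi k t *: v k) ->
  0 <= p <= 1 -> 0 <= q <= 1 ->
  vint c p q = \sum_k oint (phi k) p q *: v k.
Proof.
move=> sphi cE pI qI; rewrite (vintE pI qI (curve_rep_fin sphi cE)).
by rewrite [RHS](reindex _ (onW_bij _ (enum_val_bij T))).
Qed.

(** One representation is shared by the curve and its derivative, so linear operations act on both
    at once; any finite index type is allowed, so that sums of curves can use sum types. *)
Definition has_deriv c c' : Prop :=
  exists (T : finType) (phi : T -> R -> R) (v : T -> V),
    (forall k, smooth (phi k)) /\ forall t, 0 <= t <= 1 ->
      c t = \sum_k phi k t *: v k /\
      c' t = \sum_k derive1 (phi k) t *: v k.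

Lemma eq_has_deriv b b' c c' :
  (forall t, 0 <= t <= 1 -> c t = b t) ->
  (forall t, 0 <= t <= 1 -> c' t = b' t) ->
  has_deriv b b' -> has_deriv c c'.
Proof.
move=> cb cb' [T [phi [v [sphi E]]]]; exists T, phi, v; split=> // t tI.
by rewrite cb// cb'//; exact: E.
Qed.

Lemma has_deriv_smooth c : smooth_curve c -> has_deriv c (vderive c).
Proof.
move=> [m [phi [v rep]]]; have [sphi cE] := rep.
exists 'I_m, phi, v; split=> // t tI.
by rewrite cE// (vderiveE tI rep).
Qed.

Lemma has_deriv_cst (x : V) : has_deriv (fun=> x) (fun=> 0).
Proof.
exists unit, (fun _ _ => 1), (fun=> x); split=> [_|t tI]; first exact: smooth_cst.
by rewrite !big_const card_unit /= !addr0 scale1r derive1_cst scale0r.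
Qed.

Lemma has_derivD b b' c c' : has_deriv b b' -> has_deriv c c' ->
  has_deriv (fun t => b t + c t) (fun t => b' t + c' t).
Proof.
move=> [T [phi [v [sphi bE]]]] [U [psi [w [spsi cE]]]].
exists (T + U)%type, (fun k => match k with inl i => phi i | inr i => psi i end),
  (fun k => match k with inl i => v i | inr i => w i end).
split=> [[]//|t tI]; have [-> ->] := bE t tI; have [-> ->] := cE t tI.
by rewrite !big_sumType.
Qed.

Lemma has_deriv_scale (psi : R -> R) c c' : smooth psi -> has_deriv c c' ->
  has_deriv (fun t => psi t *: c t)
    (fun t => derive1 psi t *: c t + psi t *: c' t).
Proof.
move=> spsi [T [phi [v [sphi cE]]]].
exists T, (fun k t => psi t * phi k t), v; split=> [k|t tI]; first exact: smoothM.
have [-> ->] := cE t tI; rewrite !scaler_sumr -big_split /=.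
split; apply: eq_bigr => k _; first by rewrite scalerA.
by rewrite !scalerA derive1MD// scalerDl.
Qed.

Lemma has_derivZ (a : R) c c' : has_deriv c c' ->
  has_deriv (fun t => a *: c t) (fun t => a *: c' t).
Proof.
move=> /(has_deriv_scale (@smooth_cst R a)); apply: eq_has_deriv => // t _.
by rewrite derive1_cst scale0r add0r.
Qed.

Lemma has_deriv_sum (I : Type) (r : seq I) (P : pred I) (c c' : I -> R -> V) :
  (forall i, P i -> has_deriv (c i) (c' i)) ->
  has_deriv (fun t => \sum_(i <- r | P i) c i t)
    (fun t => \sum_(i <- r | P i) c' i t).
Proof.
move=> cc'; elim: r => [|i r IH].
  by apply: eq_has_deriv (has_deriv_cst 0) => t _; rewrite big_nil.
case: (boolP (P i)) => Pi; last first.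
  by apply: eq_has_deriv IH => t _; rewrite big_cons (negbTE Pi).
by apply: eq_has_deriv (has_derivD (cc' i Pi) IH) => t _; rewrite big_cons Pi.
Qed.

(** Leibniz rule for evaluation: linearity expands [c t] over vectors [v k] that do not depend on t,
    so only the curves [L t (v k)] and scalar coefficients are differentiated. *)
Lemma has_deriv_app (L L' : R -> V -> V) c c' :
  (forall t a x y, 0 <= t <= 1 -> L t (a *: x + y) = a *: L t x + L t y) ->
  (forall t a x y, 0 <= t <= 1 -> L' t (a *: x + y) = a *: L' t x + L' t y) ->
  (forall x, has_deriv (fun t => L t x) (fun t => L' t x)) ->
  has_deriv c c' ->
  has_deriv (fun t => L t (c t)) (fun t => L t (c' t) + L' t (c t)).
Proof.
move=> lin lin' dL [T [phi [v [sphi cE]]]].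
have sumL (M : V -> V) (f : T -> R) :
    (forall a x y, M (a *: x + y) = a *: M x + M y) ->
    M (\sum_k f k *: v k) = \sum_k f k *: M (v k).
  move=> Mlin; have M0 : M 0 = 0.
    by have := Mlin (-1) 0 0; rewrite scaler0 addr0 scaleN1r addNr.
  rewrite sum_linear//; apply: eq_bigr => k _.
  by rewrite -[in LHS](addr0 (_ *: _)) Mlin M0 addr0.
have D : has_deriv (fun t => \sum_k phi k t *: L t (v k)) (fun t =>
    \sum_k (derive1 (phi k) t *: L t (v k) + phi k t *: L' t (v k))).
  by apply: has_deriv_sum => k _; exact: has_deriv_scale.
apply: eq_has_deriv D => t tI; have [ct c't] := cE t tI.
  by rewrite ct sumL// => a x y; exact: lin.
rewrite ct c't !sumL; [|by move=> a x y; exact: lin|by move=> a x y; exact: lin'].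
by rewrite -big_split.
Qed.

(** The coefficients [phi k] need not be constant, as the [v k] may be linearly dependent. But the
    zero curve is represented both by the [derive1 (phi k)] and by the empty sum, and equating the
    two values of its integral gives c q - c p = 0. *)
Lemma has_deriv0_const c p q : has_deriv c (fun=> 0) ->
  0 <= p <= 1 -> 0 <= q <= 1 -> c p = c q.
Proof.
move=> [T [phi [v [sphi cE]]]] pI qI.
have E : vint (fun=> 0 : V) p q = \sum_k oint (derive1 (phi k)) p q *: v k.
  apply: vint_fin => // [k|t tI]; first exact: smooth_derive1.
  by have [] := cE t tI.
have := E; rewrite (vint_fin (T := void) (phi := fun=> cst 0) (v := fun=> 0))//.
- move=> /eqP; rewrite big_pred0; last by case.
  under eq_bigr do rewrite oint_derive1// scalerBl.
  by rewrite sumrB -(cE p pI).1 -(cE q qI).1 eq_sym subr_eq0 => /eqP.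
- by move=> t _; rewrite big_pred0//; case.
Qed.

End CurveCalculus.

(** * Scalar iterated integrals and reversal of the order of integration *)

Section ScalarIteratedIntegrals.
Variable R : realType.
Implicit Types (phi : nat -> R -> R) (p q s : R).

(* The same iterated integral of phi_l(t_l) .. phi_(l+i-1)(t_(l+i-1)) over
   p <= t_l <= .. <= t_(l+i-1) <= q, with the largest variable outermost
   in [upper_int] (where l = 0) and the smallest one outermost in
   [lower_int]. *)
Fixpoint upper_int (i : nat) phi p q : R :=
  if i is i'.+1 then oint (fun t => phi i' t * upper_int i' phi p t) p q else 1.

Fixpoint lower_int (i l : nat) phi p q : R :=
  if i is i'.+1 then oint (fun t => phi l t * lower_int i' l.+1 phi t q) p q
  else 1.

Lemma upper_int_smooth i phi p : (forall l, smooth (phi l)) ->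
  smooth (upper_int i phi p).
Proof.
move=> sphi; elim: i => [|i IH]; first exact: smooth_cst.
have [F [sF _ FE]] := antiderivative (smoothM (sphi i) IH).
rewrite (_ : upper_int _ _ _ = fun q => F q + - F p); last first.
  by apply/funext => q /=; rewrite FE.
exact: smoothD sF (@smooth_cst R _).
Qed.

Lemma derive1_upper_int i phi p q : (forall l, smooth (phi l)) ->
  derive1 (upper_int i.+1 phi p) q = phi i q * upper_int i phi p q.
Proof.
move=> sphi.
have [F [sF F' FE]] := antiderivative (smoothM (sphi i) (@upper_int_smooth i phi p sphi)).
rewrite (_ : upper_int _ _ _ = fun q => F q - F p); last first.
  by apply/funext => r /=; rewrite FE.
by rewrite (derive1B_cst _ (smooth_derivable sF)).2 F'.
Qed.

Lemma lower_int_smooth i l phi q : (forall l, smooth (phi l)) ->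
  smooth (fun p => lower_int i l phi p q).
Proof.
move=> sphi; elim: i l => [|i IH] l; first exact: smooth_cst.
have [F [sF _ FE]] := antiderivative (smoothM (sphi l) (IH l.+1)).
rewrite (_ : (fun p => _) = fun p => F q - 1 * F p); last first.
  by apply/funext => p /=; rewrite FE mul1r.
exact: smooth_comb (@smooth_cst R _) sF.
Qed.

Lemma derive1_lower_int i l phi p q : (forall l, smooth (phi l)) ->
  derive1 (fun p => lower_int i.+1 l phi p q) p =
  - (phi l p * lower_int i l.+1 phi p q).
Proof.
move=> sphi.
have [F [sF F' FE]] :=
  antiderivative (smoothM (sphi l) (@lower_int_smooth i l.+1 phi q sphi)).
rewrite (_ : (fun p => _) = fun p => F q - 1 * F p); last first.
  by apply/funext => r /=; rewrite FE mul1r.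
have dc : derivable (fun=> F q : R) p 1 by exact: derivable_cst.
rewrite (derive1_comb _ dc (smooth_derivable sF)) F' mul1r.
by rewrite derive1_cst sub0r.
Qed.

Lemma upper_int_refl i phi p : (forall l, smooth (phi l)) ->
  upper_int i.+1 phi p p = 0.
Proof.
move=> sphi /=.
have [F [_ _ ->]] := antiderivative (smoothM (sphi i) (@upper_int_smooth i phi p sphi)).
by rewrite subrr.
Qed.

Lemma lower_int_refl i l phi p : (forall l, smooth (phi l)) ->
  lower_int i.+1 l phi p p = 0.
Proof.
move=> sphi /=.
have [F [_ _ ->]] :=
  antiderivative (smoothM (sphi l) (@lower_int_smooth i l.+1 phi p sphi)).
by rewrite subrr.
Qed.

Lemma lower_int_shift i l phi p q :
  lower_int i l.+1 phi p q = lower_int i l (fun m => phi m.+1) p q.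
Proof.
elim: i l p => [//|i IH] l p /=; congr oint; apply/funext => t.
by rewrite IH.
Qed.

(* The sum of the products of the integral of the first variables over [p, s]
   and of the remaining ones over [s, q]. It does not depend on s: it is
   [lower_int] at s = p and [upper_int] at s = q. *)
Fixpoint mixed_int (i l : nat) phi p q s : R :=
  upper_int l phi p s * lower_int i l phi s q +
  if i is i'.+1 then mixed_int i' l.+1 phi p q s else 0.

(** By the product rule the sum telescopes: what [lower_int] contributes in one summand cancels what
    [upper_int] contributes in the next. Only the [upper_int] part of the first summand is left, and
    for l = 0 it is zero. *)
Lemma mixed_int_deriv i l phi p q : (forall l, smooth (phi l)) ->
  smooth (mixed_int i l phi p q) /\
  forall s, derive1 (mixed_int i l phi p q) s =
    if l is l'.+1 then phi l' s * upper_int l' phi p s * lower_int i l phi s q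
    else 0.
Proof.
move=> sphi.
have sup m : smooth (upper_int m phi p) by exact: upper_int_smooth.
have slo j m : smooth (fun s => lower_int j m phi s q) by exact: lower_int_smooth.
have dup m s : derive1 (upper_int m phi p) s =
    if m is m'.+1 then phi m' s * upper_int m' phi p s else 0.
  by case: m => [|m]; rewrite ?derive1_upper_int//= derive1_cst.
elim: i l => [|i IH] l.
  rewrite (_ : mixed_int 0 l phi p q = upper_int l phi p); last first.
    by apply/funext => s /=; rewrite mulr1 addr0.
  by split=> // s; rewrite dup; case: l => [//|l] /=; rewrite mulr1.
have [sI dI] := IH l.+1; have sP := smoothM (sup l) (slo i.+1 l).
split; first exact: smoothD sP sI.
move=> s; rewrite [mixed_int _ _ _ _ _](_ : _ = fun s =>
  upper_int l phi p s * lower_int i.+1 l phi s q +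
  mixed_int i l.+1 phi p q s)//.
rewrite derive1D; [|by move=> x; exact: smooth_derivable..].
rewrite derive1MD// dI derive1_lower_int// dup.
case: l {IH sI dI sP} => [|l]; last by lra.
by rewrite mul0r add0r /=; lra.
Qed.

Lemma lower_upper_int i phi p q : (forall l, smooth (phi l)) ->
  lower_int i 0 phi p q = upper_int i phi p q.
Proof.
move=> sphi; have [sm dm] := mixed_int_deriv i 0 p q sphi.
have <- : mixed_int i 0 phi p q p = lower_int i 0 phi p q.
  have mix0 j l : mixed_int j l.+1 phi p q p = 0.
    by elim: j l => [|j IH] l;
      rewrite /= -/(upper_int l.+1 phi p p) upper_int_refl// mul0r add0r//.
  by case: i {sm dm} => [|i] /=; rewrite mul1r ?mix0 addr0.
rewrite (smooth_derive0_const p q sm dm).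
rewrite -[in RHS](add0n i); elim: i 0%N {sm dm} => [|i IH] l.
  by rewrite /= mulr1 addr0 addn0.
rewrite [LHS]/= -/(lower_int i.+1 l phi q q) lower_int_refl// mulr0 add0r.
by rewrite IH addSnnS.
Qed.

End ScalarIteratedIntegrals.

(** * Iterated integrals with values in V *)

Section IteratedIntegrals.
Variables (R : realType) (V : lmodType R).
Implicit Types (h : seq R -> V) (p q t : R) (ts : seq R).

Definition on_unit ts : bool := all (fun t => 0 <= t <= 1) ts.

(** Integrands with separated variables, the analogue of [curve_rep] for i variables; for them
    [iint] reduces to [upper_int] of the coefficients. *)
Definition msmooth (i : nat) h : Prop :=
  exists (T : finType) (phi : T -> nat -> R -> R) (v : T -> V),
    (forall k l, smooth (phi k l)) /\
    forall ts, size ts = i -> on_unit ts ->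
      h ts = \sum_k (\prod_(l < i) phi k l (nth 0 ts l)) *: v k.

Lemma iintE i (T : finType) (phi : T -> nat -> R -> R) (v : T -> V) h p q :
  (forall k l, smooth (phi k l)) ->
  (forall ts, size ts = i -> on_unit ts ->
    h ts = \sum_k (\prod_(l < i) phi k l (nth 0 ts l)) *: v k) ->
  0 <= p <= 1 -> 0 <= q <= 1 ->
  iint i h p q = \sum_k upper_int i (phi k) p q *: v k.
Proof.
move=> sphi hE pI; elim: i h v q hE => [|i IH] h v q hE qI /=.
  by rewrite hE//; apply: eq_bigr => k _; rewrite big_ord0.
apply: vint_fin => // [k|t tI].
  by apply: smoothM => //; exact: upper_int_smooth.
rewrite (IH _ (fun k => phi k i t *: v k))//.
  by apply: eq_bigr => k _; rewrite scalerA mulrC.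
move=> ts tsi tsI; rewrite hE ?size_rcons ?tsi//; last first.
  by rewrite /on_unit all_rcons tI.
apply: eq_bigr => k _; rewrite big_ord_recr /= scalerA nth_rcons tsi ltnn eqxx.
by congr (_ * _ *: _); apply: eq_bigr => l _; rewrite nth_rcons tsi ltn_ord.
Qed.

Lemma eq_msmooth i h h' :
  (forall ts, size ts = i -> on_unit ts -> h ts = h' ts) ->
  msmooth i h -> msmooth i h'.
Proof.
move=> hh' [T [phi [v [sphi hE]]]]; exists T, phi, v; split=> // ts tsi tsI.
by rewrite -hh'// hE.
Qed.

Lemma eq_iint i h h' p q : msmooth i h ->
  (forall ts, size ts = i -> on_unit ts -> h ts = h' ts) ->
  0 <= p <= 1 -> 0 <= q <= 1 -> iint i h p q = iint i h' p q.
Proof.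
move=> [T [phi [v [sphi hE]]]] hh' pI qI.
rewrite (iintE sphi hE)// (iintE (h := h') (v := v) sphi)// => ts tsi tsI.
by rewrite -hh'// hE.
Qed.

Lemma msmooth0 i : msmooth i (fun=> 0).
Proof.
exists void, (fun _ _ => cst 0), (fun=> 0); split=> [[]//|ts _ _].
by rewrite big_pred0//; case.
Qed.

Lemma msmooth_cst (x : V) : msmooth 0 (fun=> x).
Proof.
exists unit, (fun _ _ => cst 1), (fun=> x); split=> [_ _|ts _ _].
  exact: smooth_cst.
by rewrite big_const card_unit /= addr0 big_ord0 scale1r.
Qed.

Section Linear.
Variables (i : nat) (c : R) (h h' : seq R -> V).
Hypotheses (mh : msmooth i h) (mh' : msmooth i h').

Lemma msmooth_iint_linear : msmooth i (fun ts => c *: h ts + h' ts) /\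
  forall p q, 0 <= p <= 1 -> 0 <= q <= 1 ->
    iint i (fun ts => c *: h ts + h' ts) p q = c *: iint i h p q + iint i h' p q.
Proof.
have [T [phi [v [sphi hE]]]] := mh; have [U [psi [w [spsi hE']]]] := mh'.
pose chi (k : T + U) := match k with inl i => phi i | inr i => psi i end.
pose x (k : T + U) := match k with inl i => c *: v i | inr i => w i end.
have schi k l : smooth (chi k l) by case: k => k; [exact: sphi|exact: spsi].
have E ts : size ts = i -> on_unit ts -> c *: h ts + h' ts =
    \sum_k (\prod_(l < i) chi k l (nth 0 ts l)) *: x k.
  move=> tsi tsI; rewrite hE// hE'// big_sumType/=; congr (_ + _).
  by rewrite scaler_sumr; apply: eq_bigr => k _; rewrite !scalerA mulrC.
split=> [|p q pI qI]; first by exists (T + U)%type, chi, x.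
rewrite (iintE schi E)// (iintE sphi hE)// (iintE spsi hE')//.
rewrite big_sumType/=; congr (_ + _).
by rewrite scaler_sumr; apply: eq_bigr => k _; rewrite !scalerA mulrC.
Qed.

Definition msmooth_linear := msmooth_iint_linear.1.
Definition iint_linear := msmooth_iint_linear.2.

End Linear.

Lemma iint0 i p q : 0 <= p <= 1 -> 0 <= q <= 1 -> iint i (fun=> 0 : V) p q = 0.
Proof.
move=> pI qI; have m0 := msmooth0 i.
have := iint_linear (-1) m0 m0 pI qI.
by rewrite [X in _ = X + _]scaleN1r addNr scaler0 addr0.
Qed.

Lemma msmooth_iint_sum i (I : Type) (r : seq I) (H : I -> seq R -> V) :
  (forall j, msmooth i (H j)) ->
  msmooth i (fun ts => \sum_(j <- r) H j ts) /\
  forall p q, 0 <= p <= 1 -> 0 <= q <= 1 ->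
    iint i (fun ts => \sum_(j <- r) H j ts) p q = \sum_(j <- r) iint i (H j) p q.
Proof.
move=> mH; elim: r => [|j r [mr IH]].
  split=> [|p q pI qI].
    by apply: eq_msmooth (msmooth0 i) => ts _ _; rewrite big_nil.
  rewrite big_nil -[RHS](iint0 i pI qI); congr iint.
  by apply/funext => ts; rewrite big_nil.
have E : (fun ts => \sum_(k <- j :: r) H k ts) =
    (fun ts => 1 *: H j ts + \sum_(k <- r) H k ts).
  by apply/funext => ts; rewrite big_cons scale1r.
rewrite E; split=> [|p q pI qI]; first exact: msmooth_linear.
by rewrite iint_linear// IH// scale1r big_cons.
Qed.

Lemma msmooth_ins i (S : Type) (x : seq S) (H : seq S -> seq S -> seq S -> seq R -> V) :
  (forall u v w, msmooth i (H u v w)) ->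
  msmooth i (fun ts => ins x (fun u v w => H u v w ts)).
Proof.
by move=> mH; apply: (msmooth_iint_sum _ _).1 => j; apply: (msmooth_iint_sum _ _).1.
Qed.

Lemma iint_ins i (S : Type) (x : seq S) (H : seq S -> seq S -> seq S -> seq R -> V) p q :
  (forall u v w, msmooth i (H u v w)) -> 0 <= p <= 1 -> 0 <= q <= 1 ->
  iint i (fun ts => ins x (fun u v w => H u v w ts)) p q =
  ins x (fun u v w => iint i (H u v w) p q).
Proof.
move=> mH pI qI; rewrite /ins /dec (msmooth_iint_sum _ _).2//.
  by apply: eq_bigr => j _; rewrite (msmooth_iint_sum _ _).2.
by move=> j; apply: (msmooth_iint_sum _ _).1.
Qed.

Lemma msmooth_cons i (psi : R -> R) h : smooth psi -> msmooth i h ->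
  msmooth i.+1 (fun ts => psi (head 0 ts) *: h (behead ts)).
Proof.
move=> spsi [T [phi [v [sphi hE]]]].
exists T, (fun k l => if l is l'.+1 then phi k l' else psi), v.
split=> [k [|l]//|[//|t ts] [tsi] /andP[_ tsI]] /=.
rewrite hE// scaler_sumr; apply: eq_bigr => k _.
by rewrite big_ord_recl scalerA.
Qed.

Lemma iint_linfun i h (L : {linear V -> V}) p q : msmooth i h ->
  0 <= p <= 1 -> 0 <= q <= 1 ->
  L (iint i h p q) = iint i (fun ts => L (h ts)) p q.
Proof.
move=> [T [phi [v [sphi hE]]]] pI qI; rewrite (iintE sphi hE)//.
rewrite (iintE (v := fun k => L (v k)) sphi)//.
  by rewrite linear_sum; apply: eq_bigr => k _; rewrite linearZ.
move=> ts tsi tsI; rewrite hE// linear_sum.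
by apply: eq_bigr => k _; rewrite linearZ.
Qed.

Lemma iint_refl i h p : msmooth i.+1 h -> 0 <= p <= 1 -> iint i.+1 h p p = 0.
Proof.
move=> [T [phi [v [sphi hE]]]] pI; rewrite (iintE sphi hE)// big1// => k _.
by rewrite upper_int_refl// scale0r.
Qed.

(** After passing to [lower_int], p is only the lower bound of the outermost integral, that of the
    first variable. Hence the minus sign and the value p in first position. *)
Lemma iint_deriv i h q : msmooth i.+1 h -> 0 <= q <= 1 ->
  has_deriv (fun p => iint i.+1 h p q)
    (fun p => - iint i (fun ts => h (p :: ts)) p q).
Proof.
move=> [T [phi [v [sphi hE]]]] qI.
exists T, (fun k p => lower_int i.+1 0 (phi k) p q), v; split=> [k|p pI].
  exact: lower_int_smooth.
split.
  by rewrite (iintE sphi hE)//; apply: eq_bigr => k _; rewrite lower_upper_int.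
rewrite (iintE (phi := fun k l => phi k l.+1) (v := fun k => phi k 0%N p *: v k))//.
  rewrite -sumrN; apply: eq_bigr => k _.
  rewrite derive1_lower_int// lower_int_shift lower_upper_int//.
  by rewrite scalerA scaleNr mulrC.
move=> ts tsi tsI; rewrite hE/= ?tsi//; last by rewrite /on_unit/= pI.
by apply: eq_bigr => k _; rewrite big_ord_recl scalerA mulrC.
Qed.

End IteratedIntegrals.

(** * Degrees and Koszul signs *)

Section Degrees.
Variables (R : realType) (V : lmodType R) (G : grading V).
Implicit Types (f g a : seq V -> V) (u v w x : seq V) (d : seq int).

Lemma homog0 e : homog G e 0.
Proof. exact: linear0. Qed.

Lemma homogD e y z : homog G e y -> homog G e z -> homog G e (y + z).
Proof. by rewrite /homog linearD => -> ->. Qed.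

Lemma homog_sum e (I : Type) (r : seq I) (F : I -> V) :
  (forall i, homog G e (F i)) -> homog G e (\sum_(i <- r) F i).
Proof.
move=> Fe; elim: r => [|i r IH]; rewrite ?big_nil ?big_cons; first exact: homog0.
exact: homogD.
Qed.

Lemma homog_seq_cons e d y x :
  homog_seq G (e :: d) (y :: x) <-> homog G e y /\ homog_seq G d x.
Proof.
split=> [[[sd] hd]|[hy [sd hd]]].
  by split; [exact: (hd 0%N)|split=> // i; exact: (hd i.+1)].
by split=> [|[|i]] //=; [rewrite sd|exact: hd].
Qed.

Lemma homog_seq_cat u w d1 d2 : homog_seq G d1 u -> homog_seq G d2 w ->
  homog_seq G (d1 ++ d2) (u ++ w).
Proof.
elim: u d1 => [|y u IH] [|e d1] hu hw //; [by case: hu|by case: hu|].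
have [hy hu'] := (homog_seq_cons e d1 y u).1 hu.
by apply/homog_seq_cons; split=> //; exact: IH.
Qed.

Lemma homog_seq_split u w d : homog_seq G d (u ++ w) ->
  exists d1 d2, [/\ d = d1 ++ d2, homog_seq G d1 u & homog_seq G d2 w].
Proof.
elim: u d => [|y u IH] d hd; first by exists [::], d.
case: d hd => [[]//|e d] /homog_seq_cons [hy hd].
have [d1 [d2 [-> h1 h2]]] := IH d hd.
by exists (e :: d1), d2; split=> //; apply/homog_seq_cons.
Qed.

Lemma in_g_multilinear k f : in_g G k f -> multilinear f.
Proof.
move=> fk u w c y z.
by have [fl _] := fk (size u + size w).+1; rewrite fl.
Qed.

Lemma homog_seq_insert a u v w d : in_g G 0 a -> homog_seq G d (u ++ v ++ w) ->
  exists d', homog_seq G d' (u ++ a v :: w) /\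
    \sum_(i <- d') i = \sum_(i <- d) i + 1 - (size v)%:Z.
Proof.
move=> a0 /homog_seq_split[d1 [d' [-> h1 /homog_seq_split[d2 [d3 [-> h2 h3]]]]]].
exists (d1 ++ (\sum_(i <- d2) i + (1 - (size v)%:Z + 0)) :: d3); split.
  apply: homog_seq_cat => //; apply/homog_seq_cons; split=> //.
  by have [_ ah] := a0 (size v); exact: ah.
by rewrite !big_cat /= big_cons; lra.
Qed.

Lemma in_g_circ0 k f a : in_g G k f -> in_g G 0 a -> in_g G k (circ0 f a).
Proof.
move=> fk a0 n; split.
  move=> u w c y z _; apply: multilinear_circ0; exact: in_g_multilinear.
move=> d x xn hd; rewrite /circ0 /ins /dec; apply: homog_sum => i.
apply: homog_sum => j; set u := take i x; set y := drop i x.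
set v := take j y; set w := drop j y.
have xE : u ++ v ++ w = x by rewrite !cat_take_drop.
rewrite -xE in hd xn; have [d' [hd' sd']] := homog_seq_insert a0 hd.
have [_ fh] := fk (size (u ++ a v :: w)).
have := fh d' _ erefl hd'; rewrite sd' -xn !size_cat /=.
by congr (homog G _ _); lia.
Qed.

(** As a has shifted degree 0, the degree of [a v] minus 1 is the sum of the degrees of the inputs,
    each reduced by 1, so both sides carry the same sign. *)
Lemma koszul_homog_in_g a v d : in_g G 0 a -> homog_seq G d v ->
  koszul G 1 (a v) = a (map (koszul G 1) v).
Proof.
move=> a0 hv; have [_ ah] := a0 (size v).
rewrite (koszul_homog 1 (ah d v erefl hv)).
have := in_hom_koszul (p := [::]) (b := [::]) 1 (a0 (size v)) _ hv.
rewrite /= !cats0 addn0 => -> //; congr (_ *: _).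
have [<- _] := hv; rewrite !mul1r; congr (_ ^ _).
elim: d {hv} => [|e d IH]; first by rewrite !big_nil.
by rewrite !big_cons -IH /=; lia.
Qed.

Lemma koszul0E y : koszul G 0 y = y.
Proof.
rewrite [RHS](gproj_sum G); apply: eq_fsbigr => i _.
by rewrite mul0r expr0z scale1r.
Qed.

Lemma koszul_vanish l : koszul G l 0 = 0.
Proof. by rewrite (koszul_homog l (homog0 0)) scaler0. Qed.

Lemma gcirc_circ l f g x : gcirc G l f g x = circ (koszul G l) f g x.
Proof. exact: (sum_ins x (fun u v w => f (map (koszul G l) u ++ g v :: w))). Qed.

Lemma gcirc_circ0 f g x : gcirc G 0 f g x = circ0 f g x.
Proof.
rewrite gcirc_circ; apply: eq_ins => u v w _.
by rewrite (eq_map koszul0E) map_id.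
Qed.

Lemma ainf_sum_circ f g d x : in_g G 0 f \/ in_g G 1 f -> g [::] = 0 ->
  homog_seq G d x -> ainf_sum d f g x = circ (koszul G 1) f g x.
Proof.
move=> fk g0 hx; have [k {}fk] : exists k, in_g G k f.
  by case: fk; [exists 0|exists 1].
(* Only [gcirc] has a summand r = 0; it inserts [g [::]], which vanishes. *)
rewrite -gcirc_circ (gcirc_homog 1 g fk hx) [RHS]big_ltn// big1 ?add0r.
  by apply: eq_bigr => r _; apply: eq_bigr => j _; rewrite mul1r.
move=> j _; rewrite /insert take0 g0.
by rewrite (multilinear0 (in_g_multilinear fk)) scaler0.
Qed.

End Degrees.

(** * Leibniz rules for insertions and for sums over blocks *)

Section InsertionDerivatives.
Variables (R : realType) (V : lmodType R).
Implicit Types (f : seq V -> V) (x : seq V).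

Lemma has_deriv_dec (S : Type) (s : seq S) (h h' : seq S -> seq S -> R -> V) :
  (forall u v, has_deriv (h u v) (h' u v)) ->
  has_deriv (fun t => dec s (fun u v => h u v t)) (fun t => dec s (fun u v => h' u v t)).
Proof. by move=> hh'; apply: has_deriv_sum => i _; exact: hh'. Qed.

Lemma has_deriv_ins (S : Type) (s : seq S) (h h' : seq S -> seq S -> seq S -> R -> V) :
  (forall u v w, has_deriv (h u v w) (h' u v w)) ->
  has_deriv (fun t => ins s (fun u v w => h u v w t))
    (fun t => ins s (fun u v w => h' u v w t)).
Proof. by move=> hh'; do 2!apply: has_deriv_dec => ? ?; exact: hh'. Qed.

Lemma has_deriv_circ (k : V -> V) (F F' mu mu' : R -> seq V -> V) x :
  (forall t, 0 <= t <= 1 -> multilinear (F t)) ->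
  (forall t, 0 <= t <= 1 -> multilinear (F' t)) ->
  (forall x, has_deriv (F^~ x) (F'^~ x)) ->
  (forall x, has_deriv (mu^~ x) (mu'^~ x)) ->
  has_deriv (fun t => circ k (F t) (mu t) x)
    (fun t => circ k (F' t) (mu t) x + circ k (F t) (mu' t) x).
Proof.
move=> Fl Fl' FF' mm'.
have D u v w : has_deriv (fun t => F t (map k u ++ mu t v :: w))
    (fun t => F t (map k u ++ mu' t v :: w) + F' t (map k u ++ mu t v :: w)).
  apply: (has_deriv_app (L := fun t y => F t (map k u ++ y :: w))
    (L' := fun t y => F' t (map k u ++ y :: w))) => // t b y z tI.
    by rewrite Fl.
  by rewrite Fl'.
apply: eq_has_deriv (has_deriv_ins x D) => // t _.
by rewrite insD addrC.
Qed.

(* If F' = F \circ a, then the sum over the compositions of the inputs is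
   transported in the same way, since a coderivation acts on F \otimes .. \otimes F
   by the Leibniz rule. *)
Lemma has_deriv_blocks (F a : R -> seq V -> V) r f x :
  (forall t, 0 <= t <= 1 -> multilinear (F t)) -> multilinear f ->
  (forall x, has_deriv (F^~ x) (fun t => circ0 (F t) (a t) x)) ->
  has_deriv (fun t => blocks (F t) r f x)
    (fun t => circ0 (blocks (F t) r f) (a t) x).
Proof.
move=> Fl + FF'; elim: r f x => [|r IH] f x fl.
  apply: eq_has_deriv (has_deriv_cst (blocks (F 0) 0 f x)) => // t _.
  by rewrite -[RHS](ins0 _ x); apply: eq_ins => -[].
have fl1 y : multilinear (fun s => f (y :: s)) := multilinear_cat [:: y] fl.
have lin1 t z c y y' :
    blocks (F t) r (fun s => f ((c *: y + y') :: s)) z =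
    c *: blocks (F t) r (fun s => f (y :: s)) z +
      blocks (F t) r (fun s => f (y' :: s)) z.
  by rewrite -blocks_linear; apply: eq_blocks => s; rewrite (fl [::]).
have D y z : has_deriv (fun t => blocks (F t) r (fun s => f (F t y :: s)) z)
    (fun t => blocks (F t) r (fun s => f (circ0 (F t) (a t) y :: s)) z +
      circ0 (blocks (F t) r (fun s => f (F t y :: s))) (a t) z).
  (* The first block's value [F t y] is the moving argument, and the remaining blocks form the
     moving linear map, differentiated by the induction hypothesis. *)
  apply: (has_deriv_app
    (L := fun t Y => blocks (F t) r (fun s => f (Y :: s)) z)
    (L' := fun t Y => circ0 (blocks (F t) r (fun s => f (Y :: s))) (a t) z)).
  - by move=> t c Y Z tI; exact: lin1.
  - move=> t c Y Z tI; rewrite -ins_linear; apply: eq_ins => u v w _.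
    exact: lin1.
  - by move=> Y; exact: IH.
  - exact: FF'.
apply: eq_has_deriv (has_deriv_dec x D) => // t _.
(* The end of the first block falls before or after the inserted [a t v], so a acts in the remaining
   blocks or in the first one. *)
transitivity (ins x (fun u v w =>
    dec u (fun u1 u2 => blocks (F t) r (fun s => f (F t u1 :: s)) (u2 ++ a t v :: w))
  + dec w (fun w1 w2 =>
      blocks (F t) r (fun s => f (F t (u ++ a t v :: w1) :: s)) w2))).
  by apply: eq_ins => u v w _; rewrite /= dec_cat.
rewrite insD addrC decD; congr (_ + _); last exact: ins_dec_left.
rewrite ins_dec_right; apply: eq_dec => y z _.
by rewrite -(linear_ins _ _ (lin1 t z)).
Qed.

End InsertionDerivatives.

(** * The identity morphism *)

Section Projection.
Variables (R : realType) (V : lmodType R) (G : grading V).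
Implicit Types (f : seq V -> V) (x : seq V).

(** This is the tree of height 0, and the value of the transport at p = q. *)
Definition arity1 x : V := if x is [:: v] then v else 0.

Lemma circ_arity1 k f x : circ k arity1 f x = f x.
Proof.
rewrite /circ /ins dec_left; last first.
  move=> b u v; rewrite -[RHS](dec0 _ v); apply: eq_dec => v1 v2 _.
  by case: u.
by rewrite dec_right.
Qed.

Lemma blocks_arity1 r f x : vanishes_at0 f ->
  blocks arity1 r f x = if size x == r then f x else 0.
Proof.
elim: r f x => [|r IH] f x f0; first by case: x.
case: x => [|b x] /=.
  rewrite dec_nil -[RHS](blocks0 arity1 r [::]); apply: eq_blocks => s.
  exact: (f0 [::]).
rewrite dec_cons -[X in X + _](_ : 0 = _) ?add0r; last first.
  by rewrite -[LHS](blocks0 arity1 r (b :: x)); apply: eq_blocks => s; rewrite (f0 [::]).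
rewrite dec_left => [|c u v].
  by rewrite IH ?eqSS// => u w; rewrite -cat_cons f0.
by rewrite -[RHS](blocks0 arity1 r v); apply: eq_blocks => s; rewrite (f0 [::]).
Qed.

Lemma arity1_in_g : in_g G 0 arity1.
Proof.
move=> n; split=> [u w c y z _|d x xn].
  by case: u => [|b []]; case: w => *; rewrite /= ?scaler0 ?addr0.
case: x xn => [|v [|v' x]] /= xn hd; [exact: homog0| |exact: homog0].
case: d hd => [[]//|e [|e' d] /homog_seq_cons[he [sd _]]]//.
by rewrite big_seq1 -xn subrr !addr0.
Qed.

End Projection.

(** * Trees, and the transport as a function of its starting point *)

Section Transport.
Variables (R : realType) (V : lmodType R) (G : grading V).
Variable a : R -> seq V -> V.
Hypothesis a_in_g : forall t, 0 <= t <= 1 -> in_g G 0 (a t).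
Hypothesis a_smooth : forall x, smooth_curve (a^~ x).
Hypothesis a_small : forall t x, 0 <= t <= 1 -> (size x <= 1)%N -> a t x = 0.
Implicit Types (x : seq V) (ts : seq R) (t p q : R).

Lemma tree_cons t ts x : vanishes_at0 (tree a ts) -> 0 <= t <= 1 ->
  tree a (t :: ts) x = circ0 (tree a ts) (a t) x.
Proof.
move=> T0 tI.
apply: (sum1_ins x (g := fun u v w => tree a ts (u ++ a t v :: w))) => u w.
by rewrite a_small.
Qed.

Lemma tree_in_g ts : on_unit ts -> in_g G 0 (tree a ts).
Proof.
elim: ts => [|t ts IH]; first by move=> _; exact: arity1_in_g.
move=> /andP[tI /IH {}IH].
rewrite (_ : tree a (t :: ts) = circ0 (tree a ts) (a t)).
  by apply: in_g_circ0 => //; exact: a_in_g.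
apply/funext => x; apply: tree_cons => //.
exact/multilinear0/(in_g_multilinear IH).
Qed.

Lemma tree_multilinear ts : on_unit ts -> multilinear (tree a ts).
Proof. by move=> /tree_in_g /in_g_multilinear. Qed.

Lemma tree_consE t ts x : on_unit (t :: ts) ->
  tree a (t :: ts) x = circ0 (tree a ts) (a t) x.
Proof.
by move=> /andP[tI tsI]; apply: tree_cons => //; exact/multilinear0/tree_multilinear.
Qed.

(* Each level of a tree decreases the number of inputs since a_t has no
   component of arity 1. *)
Lemma tree_high ts x : on_unit ts -> (size x <= size ts)%N -> tree a ts x = 0.
Proof.
elim: ts x => [|t ts IH] x tsI; first by case: x.
move=> xt; rewrite tree_consE//; have /andP[tI tsI'] := tsI.
rewrite -[RHS](ins0 _ x); apply: eq_ins => u v w xE.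
have [v1|v1] := leqP (size v) 1.
  by rewrite a_small// (multilinear0 (tree_multilinear tsI')).
apply: IH => //; move: xt; rewrite xE !size_cat /=.
by move: v1; lia.
Qed.

Lemma tree_msmooth i x : msmooth i (fun ts => tree a ts x).
Proof.
elim: i x => [|i IH] x.
  by apply: eq_msmooth (msmooth_cst (tree a [::] x)) => -[].
apply: (@eq_msmooth _ _ _ (fun ts => ins x (fun u v w =>
    tree a (behead ts) (u ++ a (head 0 ts) v :: w)))).
  by move=> [//|t ts] _ tsI; rewrite tree_consE.
(* Expanding [a t v] over fixed vectors [y k] separates the first variable from the tree in the
   remaining ones. *)
apply: msmooth_ins => u v w; have [m [phi [y [sphi aE]]]] := a_smooth v.
have := (msmooth_iint_sum (index_enum 'I_m) (fun k =>
  msmooth_cons (sphi k) (IH (u ++ y k :: w)))).1.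
apply: eq_msmooth => -[//|t ts] _ /andP[tI tsI] /=; rewrite aE//.
have Tl := tree_multilinear tsI.
rewrite (sum_linear (L := fun y => tree a ts (u ++ y :: w))).
  by apply: eq_bigr => k _; rewrite multilinearZ.
by move=> c y' z; rewrite Tl.
Qed.

Variable q : R.
Hypothesis qI : 0 <= q <= 1.
Local Notation F p := (ainf_transport a p q).

(** The term i = 0 accounts for the identity in arity 1, and terms with i at least [size x] vanish
    by [tree_high]. So the case distinction disappears, and one bound N serves inputs of different
    sizes. *)
Lemma transportE N p x : 0 <= p <= 1 -> (size x < N)%N ->
  F p x = \sum_(0 <= i < N) ((-1) ^+ i : R) *: iint i (fun ts => tree a ts x) p q.
Proof.
move=> pI xN.
have high i : (size x <= i)%N -> iint i (fun ts => tree a ts x) p q = 0.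
  move=> xi; rewrite -[RHS](iint0 V i pI qI).
  apply: eq_iint => //; first exact: tree_msmooth.
  by move=> ts tsi tsI; rewrite tree_high ?tsi.
have rest m : (size x <= m)%N -> \sum_(m <= i < N)
    ((-1) ^+ i : R) *: iint i (fun ts => tree a ts x) p q = 0.
  move=> xm; rewrite big_nat big1// => i /andP[mi _].
  by rewrite high ?scaler0// (leq_trans xm).
case: x xN high rest => [|v [|v' x]] xN high rest; rewrite /ainf_transport.
- by rewrite rest// big_geq.
- by rewrite big_ltn ?(leq_trans _ xN)// rest// addr0 expr0 scale1r.
rewrite [RHS]big_ltn ?(leq_trans _ xN)// [X in _ = X + _]scaler0 add0r.
rewrite [RHS](big_cat_nat (n := size [:: v, v' & x])) ?(ltnW xN)//=.
by rewrite (rest (size x).+2)// addr0.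
Qed.

Lemma transport_refl x : F q x = tree a [::] x.
Proof.
rewrite (transportE (N := (size x).+1))// big_ltn// expr0 scale1r /=.
rewrite big_nat big1 ?addr0// => -[//|i] _.
by rewrite iint_refl ?scaler0//; exact: tree_msmooth.
Qed.

Lemma transport_in_g p : 0 <= p <= 1 -> in_g G 0 (F p).
Proof.
move=> pI n; split=> [u w c y z szn|d x xn hd].
  have sz b : (size (u ++ b :: w) < n.+1)%N by rewrite size_cat /= addnS szn.
  rewrite !(transportE (N := n.+1))// scaler_sumr -big_split /=.
  apply: eq_bigr => i _; rewrite scalerA mulrC -scalerA -scalerDr.
  rewrite -iint_linear//; try exact: tree_msmooth.
  congr (_ *: _); apply: eq_iint => //; first exact: tree_msmooth.
  by move=> ts tsi tsI; rewrite tree_multilinear.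
rewrite (transportE (N := n.+1)) ?xn//; apply: homog_sum => i.
rewrite /homog linearZ /= iint_linfun//; last exact: tree_msmooth.
congr (_ *: _); apply: esym; apply: eq_iint => //; first exact: tree_msmooth.
move=> ts tsi tsI; apply: esym.
by have [_ Th] := tree_in_g tsI n; exact: Th.
Qed.

Lemma transport_deriv x :
  has_deriv (fun p => F p x) (fun p => circ0 (F p) (a p) x).
Proof.
pose N := (size x).+1.
have D : has_deriv (fun p => tree a [::] x + \sum_(0 <= i < N)
      ((-1) ^+ i.+1 : R) *: iint i.+1 (fun ts => tree a ts x) p q)
    (fun p => 0 + \sum_(0 <= i < N)
      ((-1) ^+ i.+1 : R) *: - iint i (fun ts => tree a (p :: ts) x) p q).
  apply: has_derivD; first exact: has_deriv_cst.
  apply: has_deriv_sum => i _; apply: has_derivZ; apply: iint_deriv => //.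
  exact: tree_msmooth.
apply: eq_has_deriv D => p pI.
  by rewrite (transportE (N := N.+1)) ?leqnSn// big_nat_recl// expr0 scale1r.
rewrite add0r.
transitivity (ins x (fun u v w => \sum_(0 <= i < N)
    ((-1) ^+ i : R) *: iint i (fun ts => tree a ts (u ++ a p v :: w)) p q)).
  apply: eq_ins => u v w xE.
  (* For empty v the new input is longer than x and out of reach of [transportE] with this N; but
     then [a p v] is zero. *)
  have [v1|v1] := leqP (size v) 0.
    rewrite a_small//; last exact: leq_trans v1 _.
    rewrite (multilinear0 (in_g_multilinear (transport_in_g pI))).
    rewrite big1// => i _; rewrite -[X in _ *: X = _](_ : 0 = _) ?scaler0//.
    rewrite -[LHS](iint0 V i pI qI); apply: eq_iint => //; first exact: msmooth0.
    by move=> ts tsi tsI; rewrite (multilinear0 (tree_multilinear tsI)).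
  rewrite (transportE (N := N))// /N xE !size_cat /= ltnS.
  by move: v1; lia.
rewrite ins_sum; apply: eq_bigr => i _; rewrite scalerN exprS mulN1r scaleNr opprK.
congr (_ *: _).
have mT u v w : msmooth i (fun ts => tree a ts (u ++ a p v :: w)).
  exact: tree_msmooth.
rewrite -(iint_ins x mT pI qI); apply: eq_iint => //; first exact: msmooth_ins.
by move=> ts tsi tsI; rewrite tree_consE// /on_unit/= pI.
Qed.

End Transport.

(** * The linear differential equation for the defect, and its vanishing *)

Section Flat.
Variables (R : realType) (V : lmodType R) (G : grading V).
Variables mu a : R -> seq V -> V.
Hypothesis mu_in_g : forall t, 0 <= t <= 1 -> in_g G 1 (mu t).
Hypothesis mu_smooth : forall x, smooth_curve (mu^~ x).
Hypothesis a_in_g : forall t, 0 <= t <= 1 -> in_g G 0 (a t).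
Hypothesis a_smooth : forall x, smooth_curve (a^~ x).
Hypothesis a_small : forall t x, 0 <= t <= 1 -> (size x <= 1)%N -> a t x = 0.
Hypothesis flat : forall t x, 0 <= t <= 1 ->
  vderive (mu^~ x) t = circ0 (mu t) (a t) x - circ (koszul G 1) (a t) (mu t) x.
Variable q : R.
Hypothesis qI : 0 <= q <= 1.
Implicit Types (x : seq V) (p t : R).

Local Notation F p := (ainf_transport a p q).
Local Notation K := (koszul G 1).

Let Fl p : 0 <= p <= 1 -> multilinear (F p).
Proof.
move=> pI; apply: in_g_multilinear.
exact: (transport_in_g a_in_g a_smooth a_small qI pI).
Qed.

Let mul p : 0 <= p <= 1 -> multilinear (mu p).
Proof. by move=> /mu_in_g /in_g_multilinear. Qed.

Let al p : 0 <= p <= 1 -> multilinear (a p).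
Proof. by move=> /a_in_g /in_g_multilinear. Qed.

Let dF x : has_deriv (fun p => F p x) (fun p => circ0 (F p) (a p) x) :=
  transport_deriv a_in_g a_smooth a_small qI x.

(** The Leibniz rule and [flat] produce the left-hand side of [circ_preLie]. Homogeneity of x is
    what lets the sign operator pass through a. *)
Lemma transport_circ_deriv d x : homog_seq G d x ->
  has_deriv (fun p => circ K (F p) (mu p) x)
    (fun p => circ0 (circ K (F p) (mu p)) (a p) x).
Proof.
move=> hx.
have D := has_deriv_circ K x Fl
  (fun t tI => multilinear_circ0 (Fl tI) (al tI)) dF
  (fun x => has_deriv_smooth (mu_smooth x)).
apply: eq_has_deriv D => // p pI.
rewrite -circ_preLie//; last 2 first.
- exact: Fl.
- move=> u v w xE; move: hx; rewrite xE.
  move=> /homog_seq_split[d1 [d' [_ _ /homog_seq_split[d2 [d3 [_ h2 _]]]]]].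
  exact: koszul_homog_in_g (a_in_g pI) h2.
by congr (_ + _); apply: eq_ins => u v w _; rewrite -flat.
Qed.

Variable M : nat.

(** The number of blocks is bounded by a fixed M rather than by [size x], because the induction
    compares the same expression on inputs of different sizes. *)
Let defect p x :=
  \sum_(1 <= r < M.+1) blocks (F p) r (mu q) x - circ K (F p) (mu p) x.

Let defect_vanishes_at0 p : 0 <= p <= 1 -> vanishes_at0 (defect p).
Proof.
move=> pI u w; have F0 := multilinear0 (Fl pI).
rewrite /defect circ_vanishes_at0 ?subr0; first last.
- exact/multilinear0/mul.
- exact: F0.
- exact: koszul_vanish.
rewrite big1// => r _; apply: blocks_vanishes_at0 => //.
exact/multilinear0/mul.
Qed.

(** At p = q all contributing blocks are singletons, so only r = [size x] survives; the bounds on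
    the size put it in the range of the sum. *)
Let defect_refl x : (0 < size x <= M)%N -> defect q x = 0.
Proof.
move=> /andP[x0 xM].
have Fq : F q = @arity1 _ V.
  by apply/funext => y; rewrite (transport_refl a_in_g a_smooth a_small qI).
have mu0 := multilinear0 (mul qI).
rewrite /defect Fq circ_arity1.
under eq_bigr do rewrite blocks_arity1//.
rewrite (bigD1_seq (size x)) ?mem_index_iota ?x0 ?iota_uniq//= eqxx.
by rewrite big1 ?addr0 ?subrr// => r; rewrite eq_sym => /negbTE ->.
Qed.

Lemma transport_blocks d p x : 0 <= p <= 1 -> homog_seq G d x ->
  (0 < size x <= M)%N ->
  \sum_(1 <= r < M.+1) blocks (F p) r (mu q) x = circ K (F p) (mu p) x.
Proof.
move=> pI hx xM; apply/eqP; rewrite -subr_eq0 -/(defect p x); apply/eqP.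
have [n] := ubnP (size x); elim: n => // n IH in d p x pI hx xM * => /ltnSE xn.
rewrite -(defect_refl xM); apply: (has_deriv0_const (c := fun p => defect p x) _ pI qI).
have D : has_deriv (fun p => defect p x) (fun p =>
    \sum_(1 <= r < M.+1) circ0 (blocks (F p) r (mu q)) (a p) x
    + (-1) *: circ0 (circ K (F p) (mu p)) (a p) x).
  apply: (eq_has_deriv (b := fun p => \sum_(1 <= r < M.+1) blocks (F p) r (mu q) x
    + (-1) *: circ K (F p) (mu p) x)) => //.
    by move=> t _; rewrite scaleN1r.
  apply: has_derivD; last by apply: has_derivZ; exact: transport_circ_deriv hx.
  by apply: has_deriv_sum => r _; apply: has_deriv_blocks => //; exact: mul.
apply: eq_has_deriv D => // {}p {}pI.
transitivity (ins x (fun u v w => defect p (u ++ a p v :: w))).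
  rewrite -[LHS](ins0 _ x); apply: eq_ins => u v w xE.
  have [v1|v1] := leqP (size v) 1.
    by rewrite a_small// defect_vanishes_at0.
  (* Insertion of the homogeneous map a keeps the inputs homogeneous, as the induction hypothesis
     demands. *)
  have [d' [hd' _]] := homog_seq_insert (a_in_g pI) (eq_ind _ (homog_seq G d) hx _ xE).
  apply: esym; apply: IH hd' _ _ => //.
    by move: xM v1; rewrite xE !size_cat /=; lia.
  by move: xn v1; rewrite xE !size_cat /=; lia.
rewrite insD insN scaleN1r; congr (_ + _).
have := ins_sum x (index_iota 1 M.+1) (fun=> 1 : R)
  (fun r u v w => blocks (F p) r (mu q) (u ++ a p v :: w)).
under [X in _ = X -> _]eq_bigr do rewrite scale1r.
move=> <-; apply: eq_ins => u v w _.
by apply: eq_bigr => r _; rewrite scale1r.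
Qed.

End Flat.

(** * Reading the Maurer-Cartan equation in components, and conclusion *)

Theorem theorem3p4 (R : realType) (V : lmodType R) (G : grading V)
    (alpha : gform V)
    (alpha_mc : maurer_cartan G alpha)
    (alpha00 : forall t : R, 0 <= t <= 1 -> form0 alpha t [::] = 0)
    (alpha10 : forall t : R, 0 <= t <= 1 -> form1 alpha t [::] = 0)
    (alpha11 : forall (t : R) (v : V), 0 <= t <= 1 ->
       form1 alpha t [:: v] = 0)
    (p q : R) (hp : 0 <= p <= 1) (hq : 0 <= q <= 1) :
  ainf_morphism G G (form0 alpha p) (form0 alpha q)
    (ainf_transport (form1 alpha) p q).
Proof.
have [[mu_g a_g mu_s a_s] mc] := alpha_mc.
have {}a_g t : 0 <= t <= 1 -> in_g G 0 (form1 alpha t).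
  by move=> tI; have := a_g t tI; rewrite subrr.
have a_small t x : 0 <= t <= 1 -> (size x <= 1)%N -> form1 alpha t x = 0.
  by case: x => [|v []]// tI _; [exact: alpha10|exact: alpha11].
(* The bracket of [alpha] with itself contains every term twice: mu \circ mu in form degree 0, and a
   \circ mu - mu \circ a in form degree 1. This cancels the factor 1/2. *)
have half (y : V) : (2^-1 : R) *: (y + y) = y.
  by rewrite -mulr2n -[y *+ 2]scaler_nat scalerA mulVf ?pnatr_eq0// scale1r.
have mumu t x : 0 <= t <= 1 -> gcirc G 1 (form0 alpha t) (form0 alpha t) x = 0.
  move=> tI; have [+ _] := mc t x tI.
  by rewrite /= /gbracket mul1r expr1z scaleN1r opprK add0r half.
have flat t x : 0 <= t <= 1 -> vderive (fun s => form0 alpha s x) t =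
    circ0 (form0 alpha t) (form1 alpha t) x
    - circ (koszul G 1) (form1 alpha t) (form0 alpha t) x.
  move=> tI; have [_ /eqP] := mc t x tI.
  rewrite /= /gbracket subrr mulr0 mul0r expr0z !scale1r expr1z scaleN1r opprB.
  by rewrite gcirc_circ0 gcirc_circ half addr_eq0 opprB => /eqP.
have alg t : 0 <= t <= 1 -> ainf_algebra G (form0 alpha t).
  move=> tI; split=> [n n1|d x x1 hx].
    by have := mu_g t tI n; congr in_hom; lia.
  by rewrite (ainf_sum_circ (or_intror (mu_g t tI)))// -?gcirc_circ ?mumu//; exact: alpha00.
have F_g := transport_in_g a_g a_s a_small hq hp.
split; [exact: alg|exact: alg| |].
  by move=> n n1; have := F_g n; rewrite addr0.
move=> d x x1 hx; rewrite (ainf_sum_circ (or_introl F_g))//; last exact: alpha00.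
have F_nil : ainf_transport (form1 alpha) p q [::] = 0 by rewrite /= big_geq.
rewrite block_sum_blocks//; last exact/multilinear0/(in_g_multilinear (mu_g q hq)).
by rewrite (transport_blocks mu_g mu_s a_g a_s a_small flat hq hp hx)// x1 leqnn.
Qed.
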